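(* Let $\tilde w=t^{m\alpha_1+n\alpha_2}\tau$ where $m,n\in\mathbb{N}_+$, $m\alpha_1+n\alpha_2\in P_+\cap Q_{sh}$, $m\neq2n-1$ and $n\neq2m-1$. Then $$f_{\tilde w,\mathbb{O}}=\begin{cases}(v-v^{-1})^2,&\mathbb{O}=\mathbb{O}_{\lambda,\tau}\text{ with }\lambda\in\bigsqcup_{j=2}^{\lfloor\frac{n+1}2\rfloor}E'_{j\alpha_1+(2j-1)\alpha_2,\tau}\ \sqcup\ \bigsqcup_{j=\lfloor\frac{n+1}2\rfloor+1}^{m}E'_{j\alpha_1+n\alpha_2,\tau},\\ v-v^{-1},&\mathbb{O}=\mathbb{O}_{i,\tau}\text{ with }1-m\leq i\leq n,\\ 1,&\mathbb{O}=\mathbb{O}_{id,\tau},\\ 0,&\text{otherwise.}\end{cases}$$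
   Context: $W=\langle s_1,s_2\rangle$ is the finite Weyl group of type $A_2$; $\alpha_1,\alpha_2$ are the simple roots, identified with the simple coroots ($\langle\alpha_i,\alpha_i\rangle=2$, $\langle\alpha_1,\alpha_2\rangle=-1$); $Q=\mathbb{Z}\alpha_1\oplus\mathbb{Z}\alpha_2$; $P$ is the coweight lattice, $P_+$ its dominant elements; $\widetilde W=P\rtimes W$ with translations $t^\lambda$. $W_a=Q\rtimes W$ is the Coxeter group generated by $s_0=t^{\alpha_1+\alpha_2}s_1s_2s_1$, $s_1$, $s_2$; $\widetilde W=W_a\rtimes\langle\tau\rangle$ with $\tau^3=1$, $\tau s_0\tau^{-1}=s_1$, $\tau s_1\tau^{-1}=s_2$, $\tau s_2\tau^{-1}=s_0$, i.e. $\tau=t^{(2\alpha_1+\alpha_2)/3}s_1s_2$; $\ell(w\tau^j)=\ell(w)$ for $w\in W_a$. $\mathbb{N}_+$ is the set of positive integers. Class polynomials: $\widetilde H$ is the algebra over $\mathbb{Z}[v,v^{-1}]$ with basis $T_{\tilde w}$ ($\tilde w\in\widetilde W$), $T_{\tilde x}T_{\tilde y}=T_{\tilde x\tilde y}$ if $\ell(\tilde x)+\ell(\tilde y)=\ell(\tilde x\tilde y)$, and $(T_s-v)(T_s+v^{-1})=0$ for $s\in\{s_0,s_1,s_2\}$. $[\widetilde H,\widetilde H]$ is the submodule spanned by commutators. For a conjugacy class $\mathbb{O}$ of $\widetilde W$, $T_{\mathbb{O}}$ is the image in $\widetilde H/[\widetilde H,\widetilde H]$ of $T_{w}$ for any minimal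 length $w\in\mathbb{O}$; by He–Nie this is well defined and the $T_{\mathbb{O}}$ form a basis. The class polynomials $f_{\tilde w,\mathbb{O}}$ are the unique coefficients with $T_{\tilde w}\equiv\sum_{\mathbb{O}}f_{\tilde w,\mathbb{O}}T_{\mathbb{O}}\bmod[\widetilde H,\widetilde H]$. Conjugacy classes of $\widetilde W$ in $W_a\tau$: $\mathbb{O}_{id,\tau}=\{t^{m\alpha_1+n\alpha_2}\tau,\ t^{m\alpha_1+n\alpha_2}s_1s_2\tau\mid m,n\in\mathbb{Z}\}$; for $\lambda\in P_+\cap Q$ not of the form $2m\alpha_1+m\alpha_2$ ($m\geq0$), $\mathbb{O}_{\lambda,\tau}$ is the class of $t^\lambda s_2s_1\tau$; for $i\in\mathbb{Z}$, $\mathbb{O}_{i,\tau}=\{t^{k\alpha_1+i\alpha_2}s_1s_2s_1\tau,\ t^{(k+i-1)\alpha_1+k\alpha_2}s_2\tau,\ t^{(1-i)\alpha_1+k\alpha_2}s_1\tau\mid k\in\mathbb{Z}\}$. $Q_{sh}=Q\setminus\{k(\alpha_1+2\alpha_2),k(2\alpha_1+\alpha_2),k(\alpha_1-\alpha_2)\mid k\in\mathbb{Z}\}$; $E'_{m\alpha_1+n\alpha_2,\tau}=\{m\alpha_1+k\alpha_2\mid\lfloor\frac{m+1}2\rfloor+1\leq k\leq n\}$. *)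

(* Defs.v *)
From HB Require Import structures.
From mathcomp Require Import all_boot all_order all_algebra.
From mathcomp Require Import boolp classical_sets cardinality fsbigop.
From mathcomp Require Import zify ring.

Set Implicit Arguments.
Unset Strict Implicit.
Unset Printing Implicit Defensive.
Import Order.TTheory GRing.Theory Num.Theory.
Local Open Scope classical_set_scope.
Local Open Scope ring_scope.

(* Z[v, v^-1], realised inside the field of rational functions Q(v). *)
Definition is_laurent (x : {fraction {poly int}}) : bool :=
  `[< exists (p : {poly int}) (n : nat),
        x = tofrac p / (tofrac 'X) ^+ n >].

Lemma fracX_neq0 n : (tofrac 'X : {fraction {poly int}}) ^+ n != 0.
Proof. by rewrite expf_neq0 // tofrac_eq0 polyX_eq0. Qed.

Lemma is_laurent_subring : subring_closed is_laurent.
Proof.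
split=> [|x y|x y]; rewrite !unfold_in.
- by apply/asboolP; exists 1, 0; rewrite expr0 divr1 tofrac1.
- move=> /asboolP[p [m ->]] /asboolP[q [n ->]]; apply/asboolP.
  exists (p * 'X ^+ n - q * 'X ^+ m), (m + n)%N.
  rewrite exprD tofracB !tofracM !tofracXn mulrBl; congr (_ - _).
    by rewrite -mulf_div divff ?fracX_neq0 ?mulr1.
  by rewrite [X in _ = _ / X]mulrC -[RHS]mulf_div divff ?fracX_neq0 ?mulr1.
- move=> /asboolP[p [m ->]] /asboolP[q [n ->]]; apply/asboolP.
  exists (p * q), (m + n)%N.
  by rewrite exprD tofracM invfM mulrACA.
Qed.

HB.instance Definition _ := GRing.isSubringClosed.Build {fraction {poly int}}
  is_laurent is_laurent_subring.

Record laurent := Laurent {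
  laurent_val :> {fraction {poly int}};
  laurent_valP : laurent_val \in is_laurent }.

HB.instance Definition _ := [isSub for laurent_val].
HB.instance Definition _ := [Choice of laurent by <:].
HB.instance Definition _ := [SubChoice_isSubComNzRing of laurent by <:].

Lemma laurent_v_subproof : tofrac 'X \in is_laurent.
Proof.
by rewrite unfold_in; apply/asboolP; exists 'X, 0; rewrite expr0 divr1.
Qed.

Lemma laurent_vV_subproof : (tofrac 'X)^-1 \in is_laurent.
Proof.
rewrite unfold_in; apply/asboolP; exists 1, 1.
by rewrite expr1 tofrac1 mul1r.
Qed.

Definition v : laurent := Laurent laurent_v_subproof.
Definition vV : laurent := Laurent laurent_vV_subproof.

Lemma v_vV : v * vV = 1.
Proof.
apply: val_inj; rewrite rmorphM rmorph1 /=.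
by rewrite mulfV // -[X in X != 0]expr1 fracX_neq0.
Qed.

(* A coweight lambda is the column of its integers <lambda, alpha_i>, that is,
   of its coordinates in the basis of fundamental coweights. *)
Definition coweight := 'cV[int]_2.

Definition cartan : 'M[int]_2 := \matrix_(i, j) (if i == j then 2 else -1).

(* Roots are identified with coroots, and <alpha_j, alpha_i> = cartan i j. *)
Definition alpha (j : 'I_2) : coweight := col j cartan.

Definition alpha1 : coweight := alpha ord0.
Definition alpha2 : coweight := alpha ord_max.

Definition root_comb (m n : int) : coweight := alpha1 *~ m + alpha2 *~ n.

(* omega1 = (2 alpha1 + alpha2) / 3 *)
Definition omega1 : coweight := delta_mx ord0 ord0.

Lemma root_combE m n :
  (root_comb m n ord0 ord0 = 2 * m - n) * (root_comb m n ord_max ord0 = 2 * n - m).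
Proof.
have mulzE (A : coweight) (k : int) i : (A *~ k) i ord0 = A i ord0 * k.
  by rewrite -scaler_int mxE intz mulrC.
by split; rewrite mxE !mulzE !mxE /=; lia.
Qed.

Lemma coweight_eq (x y : coweight) :
  x ord0 ord0 = y ord0 ord0 -> x ord_max ord0 = y ord_max ord0 -> x = y.
Proof.
move=> e0 e1; apply/colP=> -[[|[|//]] lt_i].
- by rewrite (_ : Ordinal lt_i = ord0) //; apply: val_inj.
- by rewrite (_ : Ordinal lt_i = ord_max) //; apply: val_inj.
Qed.

Lemma omega1E : omega1 *+ 3 = root_comb 2 1.
Proof.
by apply: coweight_eq; rewrite root_combE mulmxnE mxE.
Qed.

Definition root_lattice : set coweight :=
  [set lambda | exists m n : int, lambda = root_comb m n].

Definition dominant : set coweight :=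
  [set lambda | forall i, 0 <= lambda i ord0].

Definition root_lattice_sh : set coweight :=
  root_lattice `\` [set lambda | exists k : int,
    [\/ lambda = root_comb k (2 * k), lambda = root_comb (2 * k) k
      | lambda = root_comb k (- k)]].

(* s_i lambda = lambda - <lambda, alpha_i> alpha_i *)
Definition refl_mx (i : 'I_2) : 'M[int]_2 := 1 - alpha i *m delta_mx ord0 i.

(* The group generated by s_1 and s_2 inside GL_2(Z), acting on coweights. *)
Definition weyl_seq : seq 'M[int]_2 :=
  let a := refl_mx ord0 in let b := refl_mx ord_max in
  [:: 1; a; b; a * b; b * a; a * b * a].

Lemma refl_mxK i : refl_mx i * refl_mx i = 1.
Proof.
apply/matrixP=> j k; rewrite !mxE !big_ord_recl big_ord0 !mxE.
rewrite !big_ord_recl !big_ord0 !mxE.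
by case: i j k => [[|[|//]] ?] [[|[|//]] ?] [[|[|//]] ?].
Qed.

Lemma refl_mx_braid (a := refl_mx ord0) (b := refl_mx ord_max) :
  b * a * b = a * b * a.
Proof.
apply/matrixP=> j k; rewrite !mxE !big_ord_recl !big_ord0 !mxE.
rewrite !big_ord_recl !big_ord0 !mxE !big_ord_recl !big_ord0 !mxE.
by case: j k => [[|[|//]] ?] [[|[|//]] ?].
Qed.

Lemma weyl_seq_refl i A : A \in weyl_seq -> refl_mx i * A \in weyl_seq.
Proof.
have aa := refl_mxK ord0; have bb := refl_mxK ord_max.
have bab := refl_mx_braid; rewrite /= in bab.
have [->|->] : i = ord0 \/ i = ord_max.
  by case: i => [[|[|//]] ?]; [left|right]; apply: val_inj.
all: rewrite /weyl_seq /= !inE; set a := refl_mx _ in aa bab *.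
all: set b := refl_mx _ in bb bab *.
all: do ![case/orP|] => /eqP->.
all: by rewrite ?mulr1 ?mulrA ?aa ?bb ?mul1r ?bab -?mulrA ?aa ?bb ?mulr1
               ?mulrA ?eqxx ?orbT.
Qed.

Lemma weyl_seq_ind (K : 'M[int]_2 -> Prop) : K 1 ->
  (forall i A, A \in weyl_seq -> K A -> K (refl_mx i * A)) ->
  forall A, A \in weyl_seq -> K A.
Proof.
move=> K1 Kr A.
pose K' B := B \in weyl_seq /\ K B.
have K'1 : K' 1 by rewrite /K' inE eqxx.
have K'r i B : K' B -> K' (refl_mx i * B).
  by case=> WB KB; split; [apply: weyl_seq_refl | apply: Kr].
have K's i : K' (refl_mx i) by rewrite -[refl_mx i]mulr1; apply: K'r.
suff: A \in weyl_seq -> K' A by move=> KA /KA[].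
by rewrite !inE; do ![case/orP|] => /eqP->; rewrite -?mulrA; auto.
Qed.

Lemma weyl_seqM : {in weyl_seq &, forall A B, A * B \in weyl_seq}.
Proof.
move=> A B WA WB; elim/weyl_seq_ind: A / WA => [|i A _ IH].
  by rewrite mul1r.
by rewrite -mulrA weyl_seq_refl.
Qed.

Lemma weyl_seq_unit A : A \in weyl_seq ->
  A \is a GRing.unit /\ A^-1 \in weyl_seq.
Proof.
elim/weyl_seq_ind: A / => [|i A _ [uA WA]].
  by rewrite unitr1 invr1 inE eqxx.
have ui : refl_mx i \is a GRing.unit.
  by apply/unitrP; exists (refl_mx i); rewrite refl_mxK.
have iV : (refl_mx i)^-1 = refl_mx i.
  by apply: (mulrI ui); rewrite refl_mxK mulrV.
rewrite unitrMl // ui; split=> //; rewrite invrM // iV weyl_seqM //.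
by rewrite -[refl_mx i]mulr1 weyl_seq_refl // inE eqxx.
Qed.

Record weyl := Weyl { weyl_mx :> 'M[int]_2; weylP : weyl_mx \in weyl_seq }.

HB.instance Definition _ := [isSub for weyl_mx].
HB.instance Definition _ := [Choice of weyl by <:].

Lemma weyl1_subproof : 1 \in weyl_seq. Proof. by rewrite inE eqxx. Qed.

Definition weyl_one : weyl := Weyl weyl1_subproof.
Definition weyl_mul (x y : weyl) : weyl := Weyl (weyl_seqM (weylP x) (weylP y)).
Definition weyl_inv (x : weyl) : weyl := Weyl (weyl_seq_unit (weylP x)).2.

Lemma weyl_mulA : associative weyl_mul.
Proof. by move=> x y z; apply: val_inj; rewrite /= mulrA. Qed.
Lemma weyl_mul1g : left_id weyl_one weyl_mul.
Proof. by move=> x; apply: val_inj; rewrite /= mul1r. Qed.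
Lemma weyl_mulg1 : right_id weyl_one weyl_mul.
Proof. by move=> x; apply: val_inj; rewrite /= mulr1. Qed.
Lemma weyl_mulVg : left_inverse weyl_one weyl_inv weyl_mul.
Proof.
by move=> x; apply: val_inj; rewrite /= mulVr ?(weyl_seq_unit (weylP x)).1.
Qed.
Lemma weyl_mulgV : right_inverse weyl_one weyl_inv weyl_mul.
Proof.
by move=> x; apply: val_inj; rewrite /= mulrV ?(weyl_seq_unit (weylP x)).1.
Qed.

HB.instance Definition _ := isGroup.Build weyl
  weyl_mulA weyl_mul1g weyl_mulg1 weyl_mulVg weyl_mulgV.

Lemma refl_subproof i : refl_mx i \in weyl_seq.
Proof. by rewrite -[refl_mx i]mulr1 weyl_seq_refl ?weyl1_subproof. Qed.

Definition refl (i : 'I_2) : weyl := Weyl (refl_subproof i).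

(* ExtWeyl lambda u is t^lambda u, acting on coweights by x |-> lambda + u x. *)
Record ext_weyl := ExtWeyl { trans : coweight; lin : weyl }.

Definition ext_weyl_pair (x : ext_weyl) := (trans x, lin x).
Definition pair_ext_weyl (p : coweight * weyl) := ExtWeyl p.1 p.2.
Lemma ext_weyl_pairK : cancel ext_weyl_pair pair_ext_weyl.
Proof. by case. Qed.

HB.instance Definition _ := Choice.copy ext_weyl (can_type ext_weyl_pairK).

Definition ext_one : ext_weyl := ExtWeyl 0 1%g.
Definition ext_mul (x y : ext_weyl) : ext_weyl :=
  ExtWeyl (trans x + (lin x : 'M_2) *m trans y) (lin x * lin y)%g.
Definition ext_inv (x : ext_weyl) : ext_weyl :=
  ExtWeyl (- ((lin x)^-1%g : 'M_2) *m trans x) (lin x)^-1%g.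

Lemma ext_mulA : associative ext_mul.
Proof.
move=> x y z; rewrite /ext_mul /= mulgA; congr ExtWeyl.
by rewrite mulmxDr mulmxA addrA.
Qed.
Lemma ext_mul1g : left_id ext_one ext_mul.
Proof. by case=> l u; rewrite /ext_mul /= mul1g mul1mx add0r. Qed.
Lemma ext_mulg1 : right_id ext_one ext_mul.
Proof. by case=> l u; rewrite /ext_mul /= mulg1 mulmx0 addr0. Qed.
Lemma ext_mulVg : left_inverse ext_one ext_inv ext_mul.
Proof.
by case=> l u; rewrite /ext_mul /= mulVg mulNmx addNr.
Qed.
Lemma ext_mulgV : right_inverse ext_one ext_inv ext_mul.
Proof.
case=> l u; rewrite /ext_mul /= mulgV mulNmx mulmxN mulmxA.
rewrite -[(u : 'M_2) *m _]/(\val (u * u^-1)%g : 'M_2) mulgV.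
by rewrite mul1mx addrN.
Qed.

HB.instance Definition _ := isGroup.Build ext_weyl
  ext_mulA ext_mul1g ext_mulg1 ext_mulVg ext_mulgV.

Definition t (lambda : coweight) : ext_weyl := ExtWeyl lambda 1%g.
Definition fin (u : weyl) : ext_weyl := ExtWeyl 0 u.

Definition s1 : ext_weyl := fin (refl ord0).
Definition s2 : ext_weyl := fin (refl ord_max).
Definition s0 : ext_weyl := (t (root_comb 1 1) * s1 * s2 * s1)%g.
Definition tau : ext_weyl := (t omega1 * s1 * s2)%g.

Definition affine_refl (i : 'I_3) : ext_weyl := tnth [tuple s0; s1; s2] i.

Lemma refl1_act (l : coweight) :
  ((refl ord0 : 'M_2) *m l) ord0 ord0 = - l ord0 ord0 /\
  ((refl ord0 : 'M_2) *m l) ord_max ord0 = l ord0 ord0 + l ord_max ord0.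
Proof.
by split; rewrite !mxE !big_ord_recl big_ord0 !mxE !big_ord_recl !big_ord0 !mxE;
  rewrite /= (_ : lift _ _ = ord_max) //=; try (exact: val_inj); lia.
Qed.

Lemma refl2_act (l : coweight) :
  ((refl ord_max : 'M_2) *m l) ord0 ord0 = l ord0 ord0 + l ord_max ord0 /\
  ((refl ord_max : 'M_2) *m l) ord_max ord0 = - l ord_max ord0.
Proof.
by split; rewrite !mxE !big_ord_recl big_ord0 !mxE !big_ord_recl !big_ord0 !mxE;
  rewrite /= (_ : lift _ _ = ord_max) //=; try (exact: val_inj); lia.
Qed.

Lemma finM u w : (fin u * fin w = fin (u * w))%g.
Proof. by congr ExtWeyl; rewrite /= mulmx0 addr0. Qed.

Lemma tD l m : t (l + m) = (t l * t m)%g.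
Proof. by congr ExtWeyl; rewrite /= ?mul1mx ?mulg1. Qed.

Lemma fin_t u l : (fin u * t l = t ((u : 'M_2) *m l) * fin u)%g.
Proof.
by congr ExtWeyl; rewrite /= ?mul1mx ?mulg1 ?mul1g ?add0r ?addr0.
Qed.

Lemma s1K : (s1 * s1 = 1)%g.
Proof.
by rewrite finM; congr ExtWeyl; apply: val_inj; apply: refl_mxK.
Qed.

Lemma s2K : (s2 * s2 = 1)%g.
Proof.
by rewrite finM; congr ExtWeyl; apply: val_inj; apply: refl_mxK.
Qed.

Lemma s_braid : (s2 * s1 * s2 = s1 * s2 * s1)%g.
Proof.
by rewrite !finM; congr ExtWeyl; apply: val_inj; apply: refl_mx_braid.
Qed.

Lemma s1_t (l m : coweight) :
  m ord0 ord0 = - l ord0 ord0 ->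
  m ord_max ord0 = l ord0 ord0 + l ord_max ord0 -> (s1 * t l = t m * s1)%g.
Proof.
have [e0 e1] := refl1_act l; move=> m0 m1; rewrite /s1 fin_t.
by congr (t _ * _)%g; apply: coweight_eq; rewrite ?e0 ?e1.
Qed.

Lemma s2_t (l m : coweight) :
  m ord0 ord0 = l ord0 ord0 + l ord_max ord0 ->
  m ord_max ord0 = - l ord_max ord0 -> (s2 * t l = t m * s2)%g.
Proof.
have [e0 e1] := refl2_act l; move=> m0 m1; rewrite /s2 fin_t.
by congr (t _ * _)%g; apply: coweight_eq; rewrite ?e0 ?e1.
Qed.

Lemma omega1_coord : (omega1 ord0 ord0 = 1) * (omega1 ord_max ord0 = 0).
Proof. by split; rewrite mxE. Qed.

Definition cw (a b : int) : coweight := \col_i (if i == ord0 then a else b).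
Lemma cwE a b : (cw a b ord0 ord0 = a) * (cw a b ord_max ord0 = b).
Proof. by split; rewrite mxE. Qed.
Lemma s1_cw a b : (s1 * t (cw a b) = t (cw (- a) (a + b)) * s1)%g.
Proof. by apply: s1_t; rewrite !cwE. Qed.
Lemma s2_cw a b : (s2 * t (cw a b) = t (cw (a + b) (- b)) * s2)%g.
Proof. by apply: s2_t; rewrite !cwE. Qed.
Lemma t_cw a b c d : (t (cw a b) * t (cw c d) = t (cw (a + c) (b + d)))%g.
Proof.
by rewrite -tD; congr t; apply: coweight_eq; rewrite mxE !cwE.
Qed.
Lemma omega1_cw : omega1 = cw 1 0.
Proof. by apply: coweight_eq; rewrite omega1_coord cwE. Qed.
Lemma theta_cw : root_comb 1 1 = cw 1 1.
Proof. by apply: coweight_eq; rewrite root_combE cwE. Qed.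

Lemma tau_s1 : (tau * s1 = s2 * tau)%g.
Proof.
rewrite /tau omega1_cw !mulgA s2_cw.
by rewrite -!(mulgA (t _)) -s_braid.
Qed.

Lemma tau_s2 : (tau * s2 = s0 * tau)%g.
Proof.
rewrite /tau /s0 omega1_cw theta_cw -!mulgA.
rewrite (mulgA s1 (t _)) s1_cw -!mulgA (mulgA s2 (t _)) s2_cw -!mulgA.
rewrite (mulgA s1 (t _)) s1_cw -!mulgA (mulgA (t _) (t _)) t_cw.
by rewrite (mulgA s1 s1) s1K mul1g s2K mulg1.
Qed.

Lemma s1Kr x : (s1 * (s1 * x) = x)%g.
Proof. by rewrite mulgA s1K mul1g. Qed.

Lemma s2Kr x : (s2 * (s2 * x) = x)%g.
Proof. by rewrite mulgA s2K mul1g. Qed.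

Lemma s_braidr x : (s2 * (s1 * (s2 * x)) = s1 * (s2 * (s1 * x)))%g.
Proof. by rewrite 2!mulgA s_braid -!mulgA. Qed.

Lemma tau_s0 : (tau * s0 = s1 * tau)%g.
Proof.
rewrite /tau /s0 omega1_cw theta_cw -!mulgA.
rewrite (mulgA s2 (t _)) s2_cw -!mulgA (mulgA s1 (t _)) s1_cw -!mulgA.
rewrite (mulgA s1 (t _)) s1_cw -!mulgA (mulgA (t _) (t _)) t_cw.
by rewrite s_braidr !s1Kr s1K mulg1.
Qed.

Lemma tau3 : (tau ^+ 3 = 1)%g.
Proof.
have tau2 : (tau * tau = t (cw 0 1) * s2 * s1)%g.
  rewrite /tau omega1_cw -!mulgA.
  rewrite (mulgA s2 (t _)) s2_cw -!mulgA (mulgA s1 (t _)) s1_cw -!mulgA.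
  rewrite (mulgA (t _) (t _)) t_cw; congr (t _ * _)%g.
  by rewrite -s_braidr s2K mulg1.
rewrite !expgS expg0 mulg1 tau2 /tau omega1_cw -!mulgA.
rewrite (mulgA s2 (t _)) s2_cw -!mulgA (mulgA s1 (t _)) s1_cw -!mulgA.
rewrite (mulgA (t _) (t _)) t_cw (mulgA s2 s2) s2K mul1g s1K mulg1.
by congr ExtWeyl; apply: coweight_eq; rewrite cwE mxE.
Qed.

Definition affine_word (k : nat) (x : ext_weyl) : bool :=
  [exists p : k.-tuple 'I_3, [exists j : 'I_3,
    x == (\prod_(i <- p) affine_refl i * tau ^+ j)%g]].

Lemma affine_wordP k x :
  reflect (exists (p : seq 'I_3) (j : nat),
             size p = k /\ x = (\prod_(i <- p) affine_refl i * tau ^+ j)%g)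
          (affine_word k x).
Proof.
apply: (iffP existsP) => [[p /existsP[j /eqP ->]]|[p [j [sp ->]]]].
  by exists p, j; rewrite size_tuple.
exists (tcast sp (in_tuple p)); apply/existsP.
exists (Ordinal (ltn_pmod j (isT : (0 < 3)%N))).
by rewrite val_tcast /= {1}(divn_eq j 3) expgnDr mulnC expgnA tau3 expg1n mul1g.
Qed.

Lemma tau_affine_refl i :
  exists i', (tau * affine_refl i = affine_refl i' * tau)%g.
Proof.
case: i => [[|[|[|//]]] lt_i].
- by exists (inord 1); rewrite /affine_refl !(tnth_nth s0) inordK //= tau_s0.
- by exists (inord 2); rewrite /affine_refl !(tnth_nth s0) inordK //= tau_s1.
- by exists (inord 0); rewrite /affine_refl !(tnth_nth s0) inordK //= tau_s2.
Qed.

Lemma affine_word_ex x : exists k, affine_word k x.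
Proof.
pose S x := exists k, affine_word k x; rewrite -/(S x).
have Ss i y : S y -> S (affine_refl i * y)%g.
  case=> k /affine_wordP[p [j [_ ->]]]; exists (size p).+1.
  by apply/affine_wordP; exists (i :: p), j; rewrite big_cons mulgA.
have Ss1 y : S y -> S (s1 * y)%g.
  by move=> /(Ss (inord 1)); rewrite /affine_refl (tnth_nth s0) inordK.
have Ss2 y : S y -> S (s2 * y)%g.
  by move=> /(Ss (inord 2)); rewrite /affine_refl (tnth_nth s0) inordK.
have St y : S y -> S (tau * y)%g.
  case=> k /affine_wordP[p [j [_ ->]]]; exists (size p).
  have [q sq eq_q] : exists2 q, size q = size p &
      (tau * \prod_(i <- p) affine_refl i = \prod_(i <- q) affine_refl i * tau)%g.
    elim: p => [|i p [q sq IH]]; first by exists [::]; rewrite // !big_nil mulg1 mul1g.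
    have [i' ti] := tau_affine_refl i.
    exists (i' :: q); first by rewrite /= sq.
    by rewrite !big_cons mulgA ti -mulgA IH mulgA.
  by apply/affine_wordP; exists q, j.+1; rewrite mulgA eq_q -mulgA expgS.
have S1 y : S y -> S (t (cw 1 0) * y)%g.
  move=> Sy; suff -> : (t (cw 1 0) * y = tau * (s2 * (s1 * y)))%g.
    exact/St/Ss2/Ss1.
  by rewrite /tau omega1_cw -!mulgA s2Kr s1Kr.
have t1K y : (t (cw 1 0) * (t (cw (-1) 0) * y) = y)%g.
  rewrite mulgA t_cw (_ : t _ = 1%g) ?mul1g //.
  by congr ExtWeyl; apply: coweight_eq; rewrite cwE mxE.
have SN1 y : S y -> S (t (cw (-1) 0) * y)%g.
  move=> Sy; suff -> : (t (cw (-1) 0) * y = s1 * (s2 * (tau * (tau * y))))%g.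
    exact/Ss1/Ss2/St/St.
  apply: (mulgI (t (cw 1 0))); rewrite t1K -omega1_cw.
  have := tau3; rewrite !expgS expg0 mulg1 {1}/tau -!mulgA => tau3'.
  rewrite -[LHS]mul1g -tau3' -!mulgA.
  by [].
have S2 y : S y -> S (t (cw 0 (-1)) * y)%g.
  move=> Sy; suff -> : (t (cw 0 (-1)) * y =
      s2 * (s1 * (t (cw 1 0) * (s1 * (s2 * y)))))%g.
    exact/Ss2/Ss1/S1/Ss1/Ss2.
  rewrite (mulgA s1 (t _)) s1_cw -!mulgA (mulgA s2 (t _)) s2_cw -!mulgA.
  by rewrite s1Kr s2Kr.
have SN2 y : S y -> S (t (cw 0 1) * y)%g.
  move=> Sy; suff -> : (t (cw 0 1) * y =
      s2 * (s1 * (t (cw (-1) 0) * (s1 * (s2 * y)))))%g.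
    exact/Ss2/Ss1/SN1/Ss1/Ss2.
  rewrite (mulgA s1 (t _)) s1_cw -!mulgA (mulgA s2 (t _)) s2_cw -!mulgA.
  by rewrite s1Kr s2Kr.
have Sf u : S (fin u).
  case: u => A WA; suff: forall B, B \in weyl_seq -> forall u : weyl,
    weyl_mx u = B -> S (fin u) by apply; first exact: WA.
  apply: weyl_seq_ind => [u u1 | i B WB IH u uB].
    exists 0%N; apply/affine_wordP; exists [::], 0%N; split=> //.
    by rewrite big_nil mul1g; congr ExtWeyl; apply: val_inj.
  have -> : fin u = (fin (refl i) * fin (Weyl WB))%g.
    by rewrite finM; congr ExtWeyl; apply: val_inj.
  have [->|->] : i = ord0 \/ i = ord_max.
    by case: i {uB} => [[|[|//]] ?]; [left|right]; apply: val_inj.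
    exact/Ss1/IH.
  exact/Ss2/IH.
case: x => l u.
suff: S (t (cw (l ord0 ord0) (l ord_max ord0)) * fin u)%g.
  congr S; congr ExtWeyl; rewrite /= ?mul1g // mulmx0 addr0.
  by apply: coweight_eq; rewrite cwE.
have t0 y : (t (cw 0 0) * y = y)%g.
  rewrite (_ : t _ = 1%g) ?mul1g //.
  by congr ExtWeyl; apply: coweight_eq; rewrite cwE mxE.
have tab a b y : (t (cw a b) * y = t (cw a 0) * (t (cw 0 b) * y))%g.
  by rewrite mulgA t_cw addr0 add0r.
rewrite tab; set b := l ord_max _; set a := l ord0 _.
have {Sf}: S (fin u) by [].
have Sb y : S y -> S (t (cw 0 b) * y)%g.
  move=> Sy; elim/int_rect: b => [|n IH|n IH]; first by rewrite t0.
    by rewrite intS -[X in cw X]addr0 -t_cw -mulgA; exact: SN2.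
  rewrite intS opprD -[X in cw X]addr0 -t_cw -mulgA; exact: S2.
have Sa y : S y -> S (t (cw a 0) * y)%g.
  move=> Sy; elim/int_rect: a => [|n IH|n IH]; first by rewrite t0.
    by rewrite intS -[X in cw _ X]addr0 -t_cw -mulgA; exact: S1.
  by rewrite intS opprD -[X in cw _ X]addr0 -t_cw -mulgA; exact: SN1.
by move=> Su; apply/Sa/Sb.
Qed.

(* Coxeter length on W_a, extended to the whole group by l(w tau^j) = l(w). *)
Definition ell (x : ext_weyl) : nat := ex_minn (affine_word_ex x).

Definition conj_class (x : ext_weyl) : set ext_weyl :=
  [set (x ^ g)%g | g in [set: ext_weyl]].

Definition conj_classes : set (set ext_weyl) := range conj_class.

Record is_hecke_algebra (H : algType laurent) (T : ext_weyl -> H) : Prop := {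
  hecke_free : forall (s : seq ext_weyl) (c : ext_weyl -> laurent), uniq s ->
    \sum_(w <- s) c w *: T w = 0 -> forall w, w \in s -> c w = 0;
  hecke_span : forall h : H,
    exists (s : seq ext_weyl) (c : ext_weyl -> laurent),
      h = \sum_(w <- s) c w *: T w;
  hecke_mul : forall x y, (ell x + ell y)%N = ell (x * y)%g ->
    T x * T y = T (x * y)%g;
  hecke_quad : forall i : 'I_3,
    (T (affine_refl i) - v%:A) * (T (affine_refl i) + vV%:A) = 0 }.

Definition commutators (H : algType laurent) : set H :=
  [set h | exists s : seq (laurent * (H * H)),
    h = \sum_(p <- s) p.1 *: (p.2.1 * p.2.2 - p.2.2 * p.2.1)].

Definition min_length_choice (r : set ext_weyl -> ext_weyl) : Prop :=
  forall O, conj_classes O ->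
    O (r O) /\ forall y, O y -> (ell (r O) <= ell y)%N.

(* T_O is the class of T (r O), whatever the choice r of minimal length
   elements; f is a family indexed by the conjugacy classes, extended by zero
   to the other subsets of the group. *)
Definition is_class_poly (H : algType laurent) (T : ext_weyl -> H)
    (w : ext_weyl) (f : set ext_weyl -> laurent) : Prop :=
  [/\ forall O, ~ conj_classes O -> f O = 0,
      finite_set [set O | f O != 0]
    & forall r, min_length_choice r ->
        commutators (T w - \sum_(O \in conj_classes) f O *: T (r O))].

(* By He and Nie there is exactly one such f, so the default 0 is not used. *)
Definition class_poly (H : algType laurent) (T : ext_weyl -> H)
    (w : ext_weyl) : set ext_weyl -> laurent :=
  xget (fun=> 0) [set f | is_class_poly T w f].

Definition O_id_tau : set ext_weyl :=
  [set x | exists m n : int, x = (t (root_comb m n) * tau)%g \/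
                             x = (t (root_comb m n) * s1 * s2 * tau)%g].

Definition O_lambda_tau (lambda : coweight) : set ext_weyl :=
  conj_class (t lambda * s2 * s1 * tau)%g.

Definition O_int_tau (i : int) : set ext_weyl :=
  [set x | exists k : int,
    [\/ x = (t (root_comb k i) * s1 * s2 * s1 * tau)%g,
        x = (t (root_comb (k + i - 1) k) * s2 * tau)%g
      | x = (t (root_comb (1 - i) k) * s1 * tau)%g]].

(* E'_{m alpha1 + n alpha2, tau}; the lower bound on k is floor((m + 1) / 2) + 1. *)
Definition E'_tau (m n : nat) : set coweight :=
  [set lambda | exists k : nat,
    ((m + 1) %/ 2 + 1 <= k <= n)%N /\ lambda = root_comb m%:Z k%:Z].

(* Main.v *)
Require Import Defs.
From HB Require Import structures.
From mathcomp Require Import all_boot all_order all_algebra.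
From mathcomp Require Import boolp classical_sets cardinality fsbigop.
From mathcomp Require Import zify ring.

(* An element of the extended affine Weyl group is a translation, a glide reflection
   or a rotation of order three, and T_w can be reduced modulo commutators by
   T_x = T_(sxs) + (v - v^-1) T_(sx) whenever l(sxs) = l(x) - 2. Starting with the
   rotation t^(m alpha_1 + n alpha_2) tau, one such step lowers m or n by one and
   emits a glide reflection; each further step applied to that glide reflection moves
   its axis towards the base alcove and emits a translation, which is already of
   minimal length. Iterating until tau is reached gives the claimed expansion.

   That the expansion determines the class polynomials requires the linear
   independence of the T_O modulo commutators. The Hecke algebra acts on functions of
   words of three letters of zero sum in Z/N, together with a counter in Z/N: T_1 and
   T_2 exchange adjacent letters with a correction by v - v^-1, and tau rotates the
   word. Traces of these representations vanish on commutators. At v = 1 they count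
   the words fixed by a group element, and suitable words tell translations, glide
   reflections and rotations apart. A linear relation with coefficients in Z[v, v^-1]
   can be divided by v - 1 until it is nontrivial at v = 1, so it must be zero. *)

Set Implicit Arguments.
Unset Strict Implicit.
Unset Printing Implicit Defensive.
Import Order.TTheory GRing.Theory Num.Theory.
Local Open Scope classical_set_scope.
Local Open Scope ring_scope.

Local Notation q := (v - vV).

(** * The extended affine Weyl group *)

(* The elements of W as reduced words in a = s_1 and b = s_2. *)
Inductive w6 := We | Wa | Wb | Wab | Wba | Waba.

HB.instance Definition _ := gen_eqMixin w6.

(** Left multiplication by s_1; its companion [lb] is that by s_2, where bab is written as aba. *)
Definition la w := match w with
  We => Wa | Wa => We | Wb => Wab | Wab => Wb | Wba => Waba | Waba => Wba end.
Definition lb w := match w with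
  We => Wb | Wb => We | Wa => Wba | Wba => Wa | Wab => Waba | Waba => Wab end.
Definition w6mul x y := match x with
  We => y | Wa => la y | Wb => lb y | Wab => la (lb y) | Wba => lb (la y)
  | Waba => la (lb (la y)) end.

Definition acta (p : int * int) : int * int := (- p.1, p.1 + p.2).
Definition actb (p : int * int) : int * int := (p.1 + p.2, - p.2).
Definition w6act x p := match x with
  We => p | Wa => acta p | Wb => actb p | Wab => acta (actb p)
  | Wba => actb (acta p) | Waba => acta (actb (acta p)) end.

Definition wd w : ext_weyl := (match w with
  We => 1 | Wa => s1 | Wb => s2 | Wab => s1 * s2 | Wba => s2 * s1
  | Waba => s1 * s2 * s1 end)%g.

Lemma wd_la w : (s1 * wd w = wd (la w))%g.
Proof. by case: w; rewrite /= ?mulg1 ?s1K // -?mulgA ?s1Kr. Qed.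
Lemma wd_lb w : (s2 * wd w = wd (lb w))%g.
Proof.
case: w; rewrite /= ?mulg1 ?s2K ?s2Kr //.
  by rewrite mulgA s_braid.
by rewrite -s_braid -!mulgA s2Kr.
Qed.

Lemma wdM x y : (wd x * wd y = wd (w6mul x y))%g.
Proof. by case: x; rewrite /= -?mulgA ?mul1g ?wd_la ?wd_lb ?wd_la ?wd_lb ?wd_la. Qed.

Definition tc (p : int * int) : ext_weyl := t (cw p.1 p.2).

Lemma s1_tc p : (s1 * tc p = tc (acta p) * s1)%g. Proof. exact: s1_cw. Qed.
Lemma s2_tc p : (s2 * tc p = tc (actb p) * s2)%g. Proof. exact: s2_cw. Qed.

Lemma wd_tc w p : (wd w * tc p = tc (w6act w p) * wd w)%g.
Proof.
case: w; rewrite /= ?mul1g ?mulg1 -?s1_tc -?s2_tc //.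
- by rewrite -mulgA s2_tc !mulgA s1_tc -!mulgA.
- by rewrite -mulgA s1_tc !mulgA s2_tc -!mulgA.
- by rewrite -!mulgA s1_tc (mulgA s2) s2_tc !mulgA s1_tc -!mulgA.
Qed.

Definition t3 := (int * int * w6)%type.

(* (a, b, w) stands for t^(a omega_1 + b omega_2) w. *)
Definition el (x : t3) : ext_weyl := (tc x.1 * wd x.2)%g.
Definition mul3 (x y : t3) : t3 :=
  ((x.1.1 + (w6act x.2 y.1).1, x.1.2 + (w6act x.2 y.1).2), w6mul x.2 y.2).

Lemma elM x y : (el x * el y = el (mul3 x y))%g.
Proof.
rewrite /el /mul3 -mulgA (mulgA (wd _)) wd_tc -(mulgA (tc (w6act _ _))) wdM mulgA.
by congr (_ * _)%g; rewrite /tc t_cw.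
Qed.

Lemma elP x : exists y, x = el y.
Proof.
case: x => l u.
have [w ->] : exists w, u = lin (wd w).
  case: u => A WA; have := WA; rewrite {1}/weyl_seq /= !inE.
  do ![case/orP|] => /eqP eA; [exists We|exists Wa|exists Wb|exists Wab
    |exists Wba|exists Waba]; apply: val_inj; rewrite /= eA //.
exists (l ord0 ord0, l ord_max ord0, w); rewrite /el /tc.
have -> : (ExtWeyl l (lin (wd w)) = t l * ExtWeyl 0%R (lin (wd w)))%g.
  by congr ExtWeyl; rewrite /= ?mul1g ?mulmx0 ?addr0.
congr (_ * _)%g; first by congr t; apply: coweight_eq; rewrite cwE.
have e0 : trans (wd w) = 0.
  by case: w; rewrite //= ?mulmx0 ?addr0 ?add0r ?mulmx0 ?addr0.
by case: (wd w) e0 => l' u' /= ->.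
Qed.

Lemma tc_inj p q : tc p = tc q -> p = q.
Proof.
case: p q => a b [c d] [] /= e.
have := congr1 (fun z : coweight => z ord0 ord0) e.
have := congr1 (fun z : coweight => z ord_max ord0) e.
by rewrite !cwE => -> ->.
Qed.

Lemma el_inj : injective el.
Proof.
move=> [p w] [p' w'] e.
have etr q z : trans (el (q, z)) = cw q.1 q.2.
  rewrite /el /= mul1mx; suff -> : trans (wd z) = 0 by rewrite addr0.
  by case: z; rewrite //= ?mulmx0 ?addr0 ?add0r ?mulmx0 ?addr0.
have ep : p = p' by apply: tc_inj; rewrite /tc -(etr p w) e etr.
move: e; rewrite -ep /el /= => /mulgI e; congr (_, _).
(* The coweight (1, 1) is regular: its six images under W are distinct, so its image determines
   w. *)
have := wd_tc w (1, 1); rewrite e wd_tc => /mulIg/tc_inj.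
by case: (w); case: (w').
Qed.

Definition co (x : ext_weyl) : t3 := projT1 (cid (elP x)).
Lemma coK : cancel co el.
Proof. by move=> x; rewrite /co; case: (cid _). Qed.
Lemma elK : cancel el co.
Proof. by move=> x; apply: el_inj; rewrite coK. Qed.

Definition g1 : t3 := (0, 0, Wa).
Definition g2 : t3 := (0, 0, Wb).
Definition g0 : t3 := (1, 1, Waba).
Definition gtau : t3 := (1, 0, Wab).

Lemma tc0 : tc (0, 0) = 1%g.
Proof. by congr ExtWeyl; apply: coweight_eq; rewrite cwE mxE. Qed.
Lemma el_g1 : el g1 = s1. Proof. by rewrite /el /= tc0 mul1g. Qed.
Lemma el_g2 : el g2 = s2. Proof. by rewrite /el /= tc0 mul1g. Qed.
Lemma el_g0 : el g0 = s0. Proof. by rewrite /el /s0 theta_cw /= !mulgA. Qed.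
Lemma el_gtau : el gtau = tau. Proof. by rewrite /el /tau omega1_cw /= !mulgA. Qed.

(* alcove_i is the integer part, on the image of the base alcove, of alpha_1,
   alpha_2 and alpha_1 + alpha_2 respectively. *)
Definition neg1 w : int := match w with Wa | Wab | Waba => 1 | _ => 0 end.
Definition neg2 w : int := match w with Wb | Wba | Waba => 1 | _ => 0 end.
Definition neg3 w : int := match w with Wab | Wba | Waba => 1 | _ => 0 end.
Definition alcove1 (x : t3) := x.1.1 - neg1 x.2.
Definition alcove2 (x : t3) := x.1.2 - neg2 x.2.
Definition alcove3 (x : t3) := x.1.1 + x.1.2 - neg3 x.2.
(** The number of affine root hyperplanes separating the base alcove from its image, counted for
    each of the three positive roots. *)
Definition len (x : t3) : nat := (`|alcove1 x| + `|alcove2 x| + `|alcove3 x|)%N.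

Definition gen (i : 'I_3) : t3 := tnth [tuple g0; g1; g2] i.
Lemma el_gen i : el (gen i) = affine_refl i.
Proof.
by case: i => [[|[|[|//]]] ?]; rewrite /gen /affine_refl !(tnth_nth g0) !(tnth_nth s0) /=
  ?el_g0 ?el_g1 ?el_g2.
Qed.

Lemma alcove_g1 x : [/\ alcove1 (mul3 g1 x) = - alcove1 x - 1,
  alcove2 (mul3 g1 x) = alcove3 x
  & alcove3 (mul3 g1 x) = alcove2 x].
Proof. by case: x => [[a b] []]; rewrite /alcove1 /alcove2 /alcove3 /=; split; lia. Qed.
Lemma alcove_g2 x : [/\ alcove1 (mul3 g2 x) = alcove3 x,
  alcove2 (mul3 g2 x) = - alcove2 x - 1
  & alcove3 (mul3 g2 x) = alcove1 x].
Proof. by case: x => [[a b] []]; rewrite /alcove1 /alcove2 /alcove3 /=; split; lia. Qed.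
Lemma alcove_g0 x : [/\ alcove1 (mul3 g0 x) = - alcove2 x,
  alcove2 (mul3 g0 x) = - alcove1 x
  & alcove3 (mul3 g0 x) = 1 - alcove3 x].
Proof. by case: x => [[a b] []]; rewrite /alcove1 /alcove2 /alcove3 /=; split; lia. Qed.
Lemma alcove_gtau x : [/\ alcove1 (mul3 gtau x) = - alcove3 x,
  alcove2 (mul3 gtau x) = alcove1 x
  & alcove3 (mul3 gtau x) = - alcove2 x].
Proof. by case: x => [[a b] []]; rewrite /alcove1 /alcove2 /alcove3 /=; split; lia. Qed.
Lemma alcove_sum x : alcove1 x + alcove2 x <= alcove3 x <= alcove1 x + alcove2 x + 1.
Proof. by case: x => [[a b] []]; rewrite /alcove1 /alcove2 /alcove3 /=; lia. Qed.

(** The wall of the base alcove attached to generator i separates it from its image under x. *)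
Definition desc (i : 'I_3) (x : t3) : bool :=
  match val i with 0%N => 0 < alcove3 x | 1%N => alcove1 x < 0 | _ => alcove2 x < 0 end.

Lemma len_gen i x : len x = (if desc i x then (len (mul3 (gen i) x)).+1
   else (len (mul3 (gen i) x)).-1) /\ (~~ desc i x -> (0 < len (mul3 (gen i) x))%N).
Proof.
have [a b c] := alcove_g0 x; have [a' b' c'] := alcove_g1 x; have [a'' b'' c''] := alcove_g2 x.
rewrite /desc /gen !(tnth_nth g0) /len.
by case: i => [[|[|[|//]]] ?] /=; rewrite ?a ?b ?c ?a' ?b' ?c' ?a'' ?b'' ?c'';
  split; try case: ifP; lia.
Qed.

Lemma len_gtau x : len (mul3 gtau x) = len x.
Proof. by have [a b c] := alcove_gtau x; rewrite /len a b c; lia. Qed.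

Lemma len_eq0 x : len x = 0%N -> exists j : nat, el x = (tau ^+ j)%g.
Proof.
have e1 : (tau ^+ 2 = el (mul3 gtau gtau))%g by rewrite expgS expg1 -el_gtau elM.
case: x => [[a b] w]; rewrite /len /alcove1 /alcove2 /alcove3 /= => h.
case: w h => /= h; try lia.
- exists 0%N; have [-> ->] : a = 0 /\ b = 0 by lia.
  by rewrite expg0 /el /= tc0 mul1g.
- exists 1%N; have [-> ->] : a = 1 /\ b = 0 by lia.
  by rewrite expg1 -el_gtau.
- exists 2%N; have [-> ->] : a = 0 /\ b = 1 by lia.
  by rewrite e1.
Qed.

Lemma len_tau j : len (co (tau ^+ j)%g) = 0%N.
Proof.
elim: j => [|j IH].
  by rewrite (_ : co _ = (0, 0, We)) //; apply: el_inj; rewrite coK expg0 /el /= tc0 mul1g.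
rewrite (_ : co _ = mul3 gtau (co (tau ^+ j)%g)) ?len_gtau //.
by apply: el_inj; rewrite coK -elM coK el_gtau expgS.
Qed.

Lemma ex_desc x : (0 < len x)%N -> exists i, desc i x.
Proof.
move=> h; have := alcove_sum x; move: h; rewrite /len => h h'.
have [h0|h0] := boolP (0 < alcove3 x); first by exists ord0.
have [h1|h1] := boolP (alcove1 x < 0); first by exists (inord 1); rewrite /desc /= inordK.
by exists (inord 2); rewrite /desc /= inordK //; lia.
Qed.

(** Descending one generator at a time yields a word with [len x] letters. No word is shorter, since
    a generator changes [len] by one and tau preserves it. *)
Lemma ell_el x : ell (el x) = len x.
Proof.
rewrite /ell; case: ex_minnP => k /affine_wordP[p [j [sp ex]]] kmin.
apply/eqP; rewrite eqn_leq; apply/andP; split.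
  apply: kmin; apply/affine_wordP; clear.
  have [k] := ubnP (len x); elim: k x => // k IH x.
  case lx : (len x) => [|l] lk.
    have [j ->] := len_eq0 lx; move=> {lk}; exists [::], j.
    by rewrite big_nil mul1g.
  have /ex_desc[i di] : (0 < len x)%N by rewrite lx.
  have := (len_gen i x).1; rewrite di lx => -[] lx'.
  have [|p [j [sp e]]] := IH (mul3 (gen i) x); first by rewrite -lx'.
  exists (i :: p), j; rewrite /= sp -lx'; split => //.
  rewrite big_cons -mulgA -e -el_gen !elM; congr el.
  clear; case: x => [[a b] w]; rewrite /gen (tnth_nth g0).
  by case: i => [[|[|[|//]]] ?] /=; case: w; rewrite /mul3 /=; congr (_, _, _); lia.
rewrite -sp -[x]elK ex; elim: p {x k kmin sp ex} => [|i p IH] /=.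
  by rewrite big_nil mul1g len_tau.
rewrite big_cons -mulgA -el_gen -[X in (_ * X)%g]coK elM elK.
set x := co _ in IH *.
have [] := len_gen i x; case: ifP => _ /= h h'; lia.
Qed.

Lemma mul3A x y z : mul3 x (mul3 y z) = mul3 (mul3 x y) z.
Proof. by apply: el_inj; rewrite -!elM mulgA. Qed.

Lemma mul31 x : mul3 (0, 0, We) x = x.
Proof. by case: x => [[a b] w]; rewrite /mul3 /= !add0r. Qed.

Lemma gen_sq i : mul3 (gen i) (gen i) = (0, 0, We).
Proof. by case: i => [[|[|[|//]]] ?]; rewrite /gen !(tnth_nth g0). Qed.

Lemma genK i x : mul3 (gen i) (mul3 (gen i) x) = x.
Proof. by rewrite mul3A gen_sq mul31. Qed.

Lemma gen_braid i j : i != j ->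
  mul3 (mul3 (gen i) (gen j)) (gen i) = mul3 (mul3 (gen j) (gen i)) (gen j).
Proof.
by case: i j => [[|[|[|//]]] ?] [[|[|[|//]]] ?]; rewrite /gen !(tnth_nth g0).
Qed.

Lemma len_desc i x : desc i x -> len x = (len (mul3 (gen i) x)).+1.
Proof. by move=> di; rewrite (len_gen i x).1 di. Qed.

Lemma desc_gen i x : desc i (mul3 (gen i) x) = ~~ desc i x.
Proof.
have [a b c] := alcove_g0 x; have [a' b' c'] := alcove_g1 x; have [a'' b'' c''] := alcove_g2 x.
by case: i => [[|[|[|//]]] ?]; rewrite /gen /desc (tnth_nth g0) /= ?c ?a' ?b''; lia.
Qed.

(** With two descents i and j, x starts with the longest element of the dihedral group they
    generate. This reduces independence of the descents chosen to a braid relation. *)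
Lemma desc2 i j x : i != j -> desc i x -> desc j x ->
  desc j (mul3 (gen i) x) /\ desc i (mul3 (gen j) (mul3 (gen i) x)).
Proof.
rewrite /desc => ij; have := alcove_sum x.
case: i j ij => [[|[|[|//]]] ?] [[|[|[|//]]] ?] //= _; rewrite /gen !(tnth_nth g0) /=.
- have [e1 e2 e3] := alcove_g0 x; have [f1 f2 f3] := alcove_g1 (mul3 g0 x). lia.
- have [e1 e2 e3] := alcove_g0 x; have [f1 f2 f3] := alcove_g2 (mul3 g0 x). lia.
- have [e1 e2 e3] := alcove_g1 x; have [f1 f2 f3] := alcove_g0 (mul3 g1 x). lia.
- have [e1 e2 e3] := alcove_g1 x; have [f1 f2 f3] := alcove_g2 (mul3 g1 x). lia.
- have [e1 e2 e3] := alcove_g2 x; have [f1 f2 f3] := alcove_g0 (mul3 g2 x). lia.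
- have [e1 e2 e3] := alcove_g2 x; have [f1 f2 f3] := alcove_g1 (mul3 g2 x). lia.
Qed.

Definition rot3 (i : 'I_3) : 'I_3 := inord (match val i with 0 => 1 | 1 => 2 | _ => 0 end)%N.

Lemma gtau_gen i : mul3 gtau (gen i) = mul3 (gen (rot3 i)) gtau.
Proof.
by case: i => [[|[|[|//]]] ?]; rewrite /rot3 /gen !(tnth_nth g0) /= inordK.
Qed.

Lemma desc_gtau i x : desc (rot3 i) (mul3 gtau x) = desc i x.
Proof.
have [a b c] := alcove_gtau x.
by case: i => [[|[|[|//]]] ?]; rewrite /rot3 /desc /= inordK //= ?a ?b ?c; lia.
Qed.

(** * Representations of the Hecke algebra on functions of words *)

Section Rep.
Variable N : nat.
Local Notation G := 'I_N.+2.
Local Notation I := (G * G * G)%type.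
Implicit Types (i : I) (u : G * G) (g : I -> laurent) (p : int * int) (j : 'I_3).

(* A pair u is a functional on coweights, given by its values at the fundamental
   coweights; as a word of three letters with zero sum it is (u.1, u.2 - u.1, - u.2),
   and W permutes the letters. The last component of I records translations. *)
Definition ua u : G * G := (u.2 - u.1, u.2).
Definition ub u : G * G := (u.1, u.1 - u.2).
(** On functionals W acts from the right, hence the reversed order of the factors. *)
Definition uact w u : G * G := match w with
  We => u | Wa => ua u | Wb => ub u | Wab => ub (ua u)
  | Wba => ua (ub u) | Waba => ua (ub (ua u)) end.
Definition upair u p : G := u.1 *~ p.1 + u.2 *~ p.2.

Lemma uaK u : ua (ua u) = u.
Proof. by case: u => a b; rewrite /ua /=; congr (_, _); ring. Qed.
Lemma ubK u : ub (ub u) = u.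
Proof. by case: u => a b; rewrite /ub /=; congr (_, _); ring. Qed.
Lemma u_braid u : ub (ua (ub u)) = ua (ub (ua u)).
Proof. by case: u => a b; rewrite /ua /ub /=; congr (_, _); ring. Qed.

Lemma uactM x y u : uact (w6mul x y) u = uact y (uact x u).
Proof.
by case: x; case: y; rewrite /= ?uaK ?ubK ?uaK // ?u_braid ?uaK // -?u_braid ?ubK ?uaK ?ubK.
Qed.

Lemma upair_ua u p : upair (ua u) p = upair u (acta p).
Proof.
by case: u p => a b [c d]; rewrite /upair /= mulrzBl mulrzDr mulrNz; ring.
Qed.
Lemma upair_ub u p : upair (ub u) p = upair u (actb p).
Proof.
by case: u p => a b [c d]; rewrite /upair /= mulrzBl mulrzDr mulrNz; ring.
Qed.

Lemma upair_uact w u p : upair (uact w u) p = upair u (w6act w p).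
Proof. by case: w; rewrite /= ?upair_ua ?upair_ub ?upair_ua ?upair_ub ?upair_ua. Qed.

Lemma upairD u p p' : upair u (p.1 + p'.1, p.2 + p'.2) = upair u p + upair u p'.
Proof. by rewrite /upair /= !mulrzDr; ring. Qed.

Definition act (x : t3) i : I := (uact x.2 i.1, i.2 + upair i.1 x.1).

Lemma actM x y i : act (mul3 x y) i = act y (act x i).
Proof.
by case: i => u k; rewrite /act /= uactM upair_uact upairD addrA.
Qed.

Lemma act1 i : act (0, 0, We) i = i.
Proof. by case: i => u k; rewrite /act /upair /= !mulr0z !addr0. Qed.

Lemma act_genK j i : act (gen j) (act (gen j) i) = i.
Proof. by rewrite -actM gen_sq act1. Qed.

Definition letter1 i : G := i.1.1.
Definition letter2 i : G := i.1.2 - i.1.1.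
Definition letter3 i : G := - i.1.2.

(** The two letters exchanged by generator j, the word being read cyclically: s_0 compares the last
    letter with the first. *)
Definition lpair j i : G * G := match val j with
  0 => (letter3 i, letter1 i) | 1 => (letter1 i, letter2 i)
  | _ => (letter2 i, letter3 i) end%N.

Lemma letter_g1 i : [/\ letter1 (act g1 i) = letter2 i, letter2 (act g1 i) = letter1 i
  & letter3 (act g1 i) = letter3 i].
Proof. by case: i => [[a b] k]; rewrite /letter1 /letter2 /letter3 /=; split; ring. Qed.
Lemma letter_g2 i : [/\ letter1 (act g2 i) = letter1 i, letter2 (act g2 i) = letter3 i
  & letter3 (act g2 i) = letter2 i].
Proof. by case: i => [[a b] k]; rewrite /letter1 /letter2 /letter3 /=; split; ring. Qed.
Lemma letter_g0 i : [/\ letter1 (act g0 i) = letter3 i, letter2 (act g0 i) = letter2 i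
  & letter3 (act g0 i) = letter1 i].
Proof. by case: i => [[a b] k]; rewrite /letter1 /letter2 /letter3 /=; split; ring. Qed.
Lemma letter_gtau i : [/\ letter1 (act gtau i) = letter2 i, letter2 (act gtau i) = letter3 i
  & letter3 (act gtau i) = letter1 i].
Proof. by case: i => [[a b] k]; rewrite /letter1 /letter2 /letter3 /=; split; ring. Qed.

Lemma lpair_gen j i : lpair j (act (gen j) i) = ((lpair j i).2, (lpair j i).1).
Proof.
have [a b c] := letter_g0 i; have [a' b' c'] := letter_g1 i.
have [a'' b'' c''] := letter_g2 i.
by case: j => [[|[|[|//]]] ?]; rewrite /lpair /gen (tnth_nth g0) /= ?a ?c ?a' ?b' ?b'' ?c''.
Qed.

Lemma lpair_rot j i : lpair (rot3 j) i = lpair j (act gtau i).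
Proof.
have [a b c] := letter_gtau i.
by case: j => [[|[|[|//]]] ?]; rewrite /lpair /rot3 /= inordK //= ?a ?b ?c.
Qed.

(** Exchanging equal letters changes nothing; for s_0 the counter moves by the difference of these
    letters, which is zero. *)
Lemma lpair_fix j i : (lpair j i).1 = (lpair j i).2 -> act (gen j) i = i.
Proof.
case: i => [[a b] k].
case: j => [[|[|[|//]]] ?]; rewrite /lpair /gen (tnth_nth g0) /act /upair /=;
  rewrite /letter1 /letter2 /letter3 /= /ua /ub /= ?mulr0z ?addr0 => e.
- by rewrite -e !mulr1z addNr addr0; congr (_, _, _); ring.
- by rewrite -e.
- by rewrite -[a - b]opprB e opprK.
Qed.

(* At v = 1 this is the action of the reflection, because it fixes i when the two
   letters agree. *)
Definition op_gen j g : I -> laurent := fun i =>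
  if ((lpair j i).1 < (lpair j i).2)%N then g (act (gen j) i)
  else if (lpair j i).1 == (lpair j i).2 then v * g i
  else g (act (gen j) i) + q * g i.

Definition op_tau g : I -> laurent := fun i => g (act gtau i).

Lemma op_gen_quad j g : op_gen j (op_gen j g) = fun i => g i + q * op_gen j g i.
Proof.
apply: funext => i; rewrite /op_gen lpair_gen /= act_genK.
case: ltngtP => // [h|h|/val_inj e].
- by rewrite -val_eqE eq_sym /= ltn_eqF.
- by rewrite -val_eqE /= gtn_eqF //; ring.
- by rewrite e eqxx; have := v_vV; move: (v) (vV) (g i) => a b c h; ring: h.
Qed.

Lemma op_tau_gen j g : op_tau (op_gen j g) = op_gen (rot3 j) (op_tau g).
Proof.
by apply: funext => i; rewrite /op_gen /op_tau lpair_rot -!actM gtau_gen.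
Qed.

Lemma op_tau3 g : op_tau (op_tau (op_tau g)) = g.
Proof.
apply: funext => i; rewrite /op_tau -!actM (_ : mul3 _ _ = (0, 0, We)) ?act1 //.
Qed.

(** The operators of s_1 and s_2 on functions of three arbitrary letters, as in quantum Schur-Weyl
    duality. Without the zero sum, the braid relation is a case analysis on the order of the
    letters. *)
Definition sw1 (f : G -> G -> G -> laurent) (a b c : G) :=
  if (a < b)%N then f b a c else if a == b then v * f a b c else f b a c + q * f a b c.
Definition sw2 (f : G -> G -> G -> laurent) (a b c : G) :=
  if (b < c)%N then f a c b else if b == c then v * f a b c else f a c b + q * f a b c.

Lemma sw_braid f a b c : sw1 (sw2 (sw1 f)) a b c = sw2 (sw1 (sw2 f)) a b c.
Proof.
rewrite /sw1 /sw2; have vv := v_vV; rewrite -!val_eqE /=.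
case: (ltngtP a b) => [h1|h1|/val_inj h1]; case: (ltngtP b c) => [h2|h2|/val_inj h2];
case: (ltngtP a c) => [h3|h3|/val_inj h3]; subst; rewrite ?ltnn ?eqxx //=; try lia;
 ring: vv.
Qed.


(** The third letter is forced by the zero sum, so only words with a + b + c = 0 are read
    faithfully. *)
Definition wordfun g (k : G) (a b c : G) := g (a, a + b, k).

Lemma wordfunE g i : wordfun g i.2 (letter1 i) (letter2 i) (letter3 i) = g i.
Proof.
case: i => [[a b] k]; have e : a + (b - a) = b by ring.
by rewrite -[in RHS]e.
Qed.

Lemma lpair1 i : lpair (inord 1) i = (letter1 i, letter2 i).
Proof. by rewrite /lpair [val _]inordK. Qed.
Lemma lpair2 i : lpair (inord 2) i = (letter2 i, letter3 i).
Proof. by rewrite /lpair [val _]inordK. Qed.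
Lemma gen1 : gen (inord 1) = g1.
Proof. by rewrite /gen (tnth_nth g0) /= inordK. Qed.
Lemma gen2 : gen (inord 2) = g2.
Proof. by rewrite /gen (tnth_nth g0) /= inordK. Qed.

Lemma op_gen_sw1 g i : op_gen (inord 1) g i
  = sw1 (wordfun g i.2) (letter1 i) (letter2 i) (letter3 i).
Proof.
have := wordfunE g (act g1 i); have [-> -> ->] := letter_g1 i => e.
have e2 : (act g1 i).2 = i.2 by rewrite /act /upair !mulr0z !addr0.
by rewrite /op_gen /sw1 lpair1 gen1 wordfunE -e e2.
Qed.

Lemma op_gen_sw2 g i : op_gen (inord 2) g i
  = sw2 (wordfun g i.2) (letter1 i) (letter2 i) (letter3 i).
Proof.
have := wordfunE g (act g2 i); have [-> -> ->] := letter_g2 i => e.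
have e2 : (act g2 i).2 = i.2 by rewrite /act /upair !mulr0z !addr0.
by rewrite /op_gen /sw2 lpair2 gen2 wordfunE -e e2.
Qed.

Lemma word_letters (k a b c : G) : a + b + c = 0 ->
  letter2 (a, a + b, k) = b /\ letter3 (a, a + b, k) = c.
Proof.
move=> e; split; first by rewrite /letter2 /= (addrC a) addrK.
by apply: (addrI (a + b)); rewrite e /letter3 /= addrN.
Qed.

Lemma wordfun1 g k a b c : a + b + c = 0 ->
  wordfun (op_gen (inord 1) g) k a b c = sw1 (wordfun g k) a b c.
Proof.
move=> e; have [e2 e3] := word_letters k e.
by rewrite {1}/wordfun op_gen_sw1 e2 e3.
Qed.

Lemma wordfun2 g k a b c : a + b + c = 0 ->
  wordfun (op_gen (inord 2) g) k a b c = sw2 (wordfun g k) a b c.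
Proof.
move=> e; have [e2 e3] := word_letters k e.
by rewrite {1}/wordfun op_gen_sw2 e2 e3.
Qed.

Lemma sw1_eq f f' a b c : (forall a b c : G, a + b + c = 0 -> f a b c = f' a b c) ->
  a + b + c = 0 -> sw1 f a b c = sw1 f' a b c.
Proof. by move=> ff e; rewrite /sw1 !ff // (addrC b). Qed.

Lemma sw2_eq f f' a b c : (forall a b c : G, a + b + c = 0 -> f a b c = f' a b c) ->
  a + b + c = 0 -> sw2 f a b c = sw2 f' a b c.
Proof. by move=> ff e; rewrite /sw2 !ff // addrAC. Qed.

Lemma op_gen_braid12 g (j1 := inord 1) (j2 := inord 2) :
  op_gen j1 (op_gen j2 (op_gen j1 g)) = op_gen j2 (op_gen j1 (op_gen j2 g)).
Proof.
apply: funext => i; rewrite op_gen_sw1 op_gen_sw2.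
have e : letter1 i + letter2 i + letter3 i = 0.
  by rewrite /letter1 /letter2 /letter3; ring.
rewrite -(@sw1_eq (sw2 (sw1 (wordfun g i.2)))) // => [|a b c e'].
  rewrite -(@sw2_eq (sw1 (sw2 (wordfun g i.2)))) // => [|a b c e']; first exact: sw_braid.
  by rewrite wordfun1 //; apply: sw1_eq => // x y z e''; rewrite wordfun2.
by rewrite wordfun2 //; apply: sw2_eq => // x y z e''; rewrite wordfun1.
Qed.

Lemma op_gen_braid j j' g : j != j' ->
  op_gen j (op_gen j' (op_gen j g)) = op_gen j' (op_gen j (op_gen j' g)).
Proof.
have r (k : 'I_3) : [\/ k = inord 0, k = inord 1 | k = inord 2].
  by case: k => [[|[|[|//]]] ?]; [constructor 1 | constructor 2 | constructor 3];
     apply: val_inj; rewrite /= inordK.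
have r1 : rot3 (inord 1) = inord 2 by rewrite /rot3 /= inordK.
have r2 : rot3 (inord 2) = inord 0 by rewrite /rot3 /= inordK.
have r0 : rot3 (inord 0) = inord 1 by rewrite /rot3 /= inordK.
have b12 g' : op_gen (inord 1) (op_gen (inord 2) (op_gen (inord 1) g'))
            = op_gen (inord 2) (op_gen (inord 1) (op_gen (inord 2) g')) := op_gen_braid12 g'.
have o0 g' : op_tau (op_gen (inord 0) g') = op_gen (inord 1) (op_tau g') by rewrite op_tau_gen r0.
have o1 g' : op_tau (op_gen (inord 1) g') = op_gen (inord 2) (op_tau g') by rewrite op_tau_gen r1.
have o2 g' : op_tau (op_gen (inord 2) g') = op_gen (inord 0) (op_tau g') by rewrite op_tau_gen r2.
have o3 := op_tau3.
move: b12 o0 o1 o2 o3 r; rewrite -[j != j']/(~~ (j == j')).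
move: (op_gen) (op_tau) => O o b12 o0 o1 o2 o3 r.
(* The other two braid relations are conjugates of the first by [op_tau], whose cube is the
   identity. *)
have b20 g' : O (inord 2) (O (inord 0) (O (inord 2) g'))
            = O (inord 0) (O (inord 2) (O (inord 0) g')).
  by rewrite -(o3 g') -o1 -o2 -o1 b12 o2 o1 o2.
have b01 g' : O (inord 0) (O (inord 1) (O (inord 0) g'))
            = O (inord 1) (O (inord 0) (O (inord 1) g')).
  by rewrite -(o3 g') -o2 -o0 -o2 b20 o0 o2 o0.
by case: (r j) => ->; case: (r j') => ->; rewrite ?eqxx.
Qed.

(* The value does not depend on the descents chosen (rho_desc): this is
   Matsumoto's theorem, and only needs the braid relations of op_gen. *)
Fixpoint rhon n (x : t3) : (I -> laurent) -> I -> laurent := match n with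
  | 0 => fun g i => g (act x i)
  | n'.+1 => if [pick j | desc j x] is Some j
             then fun g => op_gen j (rhon n' (mul3 (gen j) x) g)
             else fun g i => g (act x i) end%N.

Definition rho x := rhon (len x) x.

Lemma rho_desc j x g : desc j x -> rho x g = op_gen j (rho (mul3 (gen j) x) g).
Proof.
have [n] := ubnP (len x); elim: n => // n IH in j x g *.
move=> lx dj; rewrite /rho (len_desc dj) /=.
case: pickP => [j' dj'|]; last by move/(_ j); rewrite dj.
have elen : len (mul3 (gen j) x) = len (mul3 (gen j') x).
  by apply: succn_inj; rewrite -!len_desc.
have [<-|nj] := eqVneq j j'; first by [].
rewrite [in LHS]elen -/(rho _ _) -/(rho _ _).
(* Both expansions continue to the same element, three steps below x, and differ only by a braid
   relation. *)
have [d1 d2] := desc2 nj dj dj'; rewrite eq_sym in nj.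
have [d1' d2'] := desc2 nj dj' dj.
have lj := len_desc dj; have lj' := len_desc dj'.
have ll : (len (mul3 (gen j) (mul3 (gen j') x)) < n)%N.
  by have := len_desc d1'; lia.
have ll' : (len (mul3 (gen j') (mul3 (gen j) x)) < n)%N.
  by have := len_desc d1; lia.
rewrite (IH j _ _ _ d1'); last lia.
rewrite (IH j' _ _ _ d1); last lia.
rewrite (IH _ _ _ ll d2') (IH _ _ _ ll' d2) op_gen_braid // !mul3A.
by rewrite gen_braid.
Qed.

(** The counterpart of [gen_mul]: [op_gen] acts on the operators [rho x] as T_s acts on the basis by
    left multiplication. *)
Lemma rho_gen j x g : op_gen j (rho x g) =
  if desc j x then fun i => rho (mul3 (gen j) x) g i + q * rho x g i
  else rho (mul3 (gen j) x) g.
Proof.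
case: ifP => dj; last first.
  by rewrite (@rho_desc j (mul3 (gen j) x)) ?genK // desc_gen dj.
rewrite (rho_desc g dj) op_gen_quad; apply: funext => i.
by rewrite -(rho_desc g dj).
Qed.

Lemma rho_len0 x g : len x = 0%N -> rho x g = fun i => g (act x i).
Proof. by rewrite /rho => ->. Qed.

Lemma op_tau_rho x g : op_tau (rho x g) = rho (mul3 gtau x) g.
Proof.
move: {-1}(len x) (erefl (len x)) => n; elim: n x => [|n IH] x lx.
  by rewrite !rho_len0 ?len_gtau // /op_tau; apply: funext => i; rewrite actM.
have /ex_desc[j dj] : (0 < len x)%N by rewrite lx.
have lj := len_desc dj.
rewrite (rho_desc g dj) op_tau_gen IH; last by lia.
have e : mul3 gtau (mul3 (gen j) x) = mul3 (gen (rot3 j)) (mul3 gtau x).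
  by rewrite !mul3A gtau_gen.
by rewrite e -rho_desc // desc_gtau.
Qed.

Lemma rho_ind (K : ((I -> laurent) -> I -> laurent) -> Prop) :
  (forall x, K (fun g i => g (act x i))) ->
  (forall j A, K A -> K (fun g => op_gen j (A g))) -> forall x, K (rho x).
Proof.
move=> Ka KT x; rewrite /rho; move: (len x) => n; elim: n x => [|n IH] x /=; first exact: Ka.
by case: pickP => [j _|_]; [apply: KT | apply: Ka].
Qed.

Lemma op_genD j (a : laurent) g h :
  op_gen j (fun i => a * g i + h i) = fun i => a * op_gen j g i + op_gen j h i.
Proof.
apply: funext => i; rewrite /op_gen; case: ifP => // _; case: ifP => _; ring.
Qed.

Definition w6inv w := match w with Wab => Wba | Wba => Wab | _ => w end.
Lemma uactK w u : uact (w6inv w) (uact w u) = u.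
Proof. by rewrite -uactM; case: w. Qed.

Variables (u0 : G * G) (s : G).
Definition content i :=
  has (fun w => i.1 == uact w u0) [:: We; Wa; Wb; Wab; Wba; Waba].
Definition shift i : I := (i.1, i.2 + s).

Lemma contentP i : reflect (exists w, i.1 = uact w u0) (content i).
Proof.
apply: (iffP idP) => [/hasP[w _ /eqP]|[w e]]; first by exists w.
by apply/hasP; exists w; [case: w {e}; rewrite !inE eqxx ?orbT | apply/eqP].
Qed.

Lemma content_act x i : content (act x i) = content i.
Proof.
apply/contentP/contentP => -[w /= e]; last by exists (w6mul w x.2); rewrite uactM e.
by exists (w6mul w (w6inv x.2)); rewrite uactM -e uactK.
Qed.

Lemma act_shift x i : act x (shift i) = shift (act x i).
Proof. by rewrite /act /shift /= addrAC. Qed.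

Lemma shift_inj : injective shift.
Proof. by case=> [u k] [u' k']; rewrite /shift /= => /pair_equal_spec[-> /addIr->]. Qed.

Lemma content_shift i : content (shift i) = content i. Proof. by []. Qed.

Definition delta i : I -> laurent := fun i' => (i' == i)%:R.

(** What makes the twisted trace cyclic: A is given by a matrix, is block diagonal for the content,
    and commutes with the shift of the counter. *)
Record admissible (A : (I -> laurent) -> I -> laurent) : Prop := {
  adm_lin : forall g i, A g i = \sum_i' g i' * A (delta i') i;
  adm_content : forall b g, (forall i, content i != b -> g i = 0) ->
     forall i, content i != b -> A g i = 0;
  adm_shift : forall g, A (g \o shift) = A g \o shift }.

Lemma delta_sum g i : g i = \sum_i' g i' * delta i' i.
Proof.
rewrite (bigD1 i) //= /delta eqxx mulr1 big1 ?addr0 // => i' ni.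
by rewrite eq_sym (negbTE ni) mulr0.
Qed.

Lemma rho_admissible x : admissible (rho x).
Proof.
apply: rho_ind => {x} [x|j A [lA cA sA]]; split.
- by move=> g i; exact: delta_sum.
- by move=> b g gb i ib; apply: gb; rewrite content_act.
- by move=> g; apply: funext => i /=; rewrite act_shift.
- move=> g i; rewrite /op_gen; case: ifP => _; first exact: lA.
  case: ifP => _; first by rewrite lA big_distrr; apply: eq_bigr => i' _ /=; ring.
  rewrite lA (lA _ i) big_distrr -big_split /=.
  by apply: eq_bigr => i' _; ring.
- move=> b g gb i ib; rewrite /op_gen.
  by rewrite !(cA b g) ?content_act // !mulr0 addr0; case: ifP => //; case: ifP.
- move=> g; apply: funext => i; rewrite /op_gen sA /= act_shift.
  by have -> : lpair j (shift i) = lpair j i.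
Qed.

(* The trace of A twisted by shift, restricted to the orbit of the word u0. *)
Definition tr (A : (I -> laurent) -> I -> laurent) : laurent :=
  \sum_(i | content i) A (delta (shift i)) i.

Lemma tr_comm A B : admissible A -> admissible B -> tr (A \o B) = tr (B \o A).
Proof.
move=> hA hB.
have trE A' B' : admissible A' -> admissible B' -> tr (A' \o B') =
    \sum_(i | content i) \sum_(k | content k) B' (delta (shift i)) k * A' (delta k) i.
  move=> hA' hB'; apply: eq_bigr => i ci /=; rewrite (adm_lin hA').
  rewrite (bigID content) /= [X in _ + X]big1 ?addr0 // => k ck.
  rewrite (adm_content hB' (b := true)) ?mul0r //; last by case: content ck.
  by move=> i'; rewrite /delta; have [->|//] := eqVneq i'; rewrite content_shift ci.
rewrite (trE _ _ hA hB) (trE _ _ hB hA) [RHS]exchange_big /=.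
rewrite [RHS](reindex_inj shift_inj) /=.
(* It remains to move the twist from one index of the matrix of A to the other, which is possible
   because A commutes with [shift]. *)
apply: eq_bigr => i ci; apply: eq_bigr => k ck; rewrite mulrC; congr (_ * _).
have -> : delta k = delta (shift k) \o shift.
  by apply: funext => z; rewrite /delta /= (inj_eq shift_inj).
by rewrite (adm_shift hA).
Qed.

End Rep.

(** * Traces vanish on commutators *)

Section Hecke.
Variables (H : algType laurent) (T : ext_weyl -> H) (HT : is_hecke_algebra T).
Implicit Types x y : t3.

Local Notation E x := (T (el x)).

Lemma E_mul x y : (len x + len y)%N = len (mul3 x y) -> E x * E y = E (mul3 x y).
Proof. by move=> h; rewrite (hecke_mul HT) elM // !ell_el. Qed.

(** [T 1] is a left unit for every [T w]; expanding the unit of [H] in this spanning family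
    identifies the two. *)
Lemma T_one : T 1%g = 1.
Proof.
have e1 : 1%g = el (0, 0, We) by rewrite /el /= tc0 mul1g.
have T1 x : T 1%g * E x = E x by rewrite e1 E_mul ?mul31.
have [l [c e]] := hecke_span HT 1.
rewrite -[LHS]mulr1 e big_distrr /=; apply: eq_bigr => w _.
by rewrite -scalerAr -[w]coK T1.
Qed.

Lemma gen_sqr j : E (gen j) * E (gen j) = 1 + q *: E (gen j).
Proof.
have := hecke_quad HT j; rewrite -el_gen mulrDr !mulrBl; set g := E _.
rewrite -!scalerAl -!scalerAr !mulr1 !mul1r scalerA v_vV scale1r => e.
have {}e : g * g + vV *: g = 1 + v *: g.
  by apply/eqP; rewrite -subr_eq0 -e opprD (addrC (- 1)) addrACA.
by rewrite scalerBl addrA -e addrK.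
Qed.

Lemma gen_mul j x : E (gen j) * E x =
  if desc j x then E (mul3 (gen j) x) + q *: E x else E (mul3 (gen j) x).
Proof.
have up y : ~~ desc j y -> E (gen j) * E y = E (mul3 (gen j) y).
  move=> dj; apply: E_mul; have := len_desc (i := j) (x := mul3 (gen j) y).
  rewrite desc_gen genK dj => ->//; suff -> : len (gen j) = 1%N by [].
  by case: j {dj} => [[|[|[|//]]] ?]; rewrite /gen (tnth_nth g0).
case: ifP => dj; last by rewrite up ?dj.
have e : E (gen j) * E (mul3 (gen j) x) = E x.
  by rewrite up ?desc_gen ?dj // genK.
by rewrite -{1}e mulrA gen_sqr mulrDl mul1r -scalerAl e.
Qed.

Lemma expand h : exists l : seq (laurent * t3), h = \sum_(p <- l) p.1 *: E p.2.
Proof.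
have [l [c ->]] := hecke_span HT h; exists [seq (c w, co w) | w <- l].
by rewrite big_map; apply: eq_bigr => w _ /=; rewrite coK.
Qed.

(** As the [T w] are free, every function on the group extends to a linear form. A list may repeat
    an element, so equal terms are collected first. *)
Lemma relation_transfer (f : t3 -> laurent) (l : seq (laurent * t3)) :
  \sum_(p <- l) p.1 *: E p.2 = 0 -> \sum_(p <- l) p.1 * f p.2 = 0.
Proof.
move=> e; pose ws := undup [seq el p.2 | p <- l].
pose c w := \sum_(p <- l | el p.2 == w) p.1.
have grp (V : nmodType) (F : laurent * t3 -> V) :
    \sum_(p <- l) F p = \sum_(w <- ws) \sum_(p <- l | el p.2 == w) F p.
  rewrite [RHS](exchange_big_dep predT) //=; apply: eq_big_seq => p pl.
  rewrite big_mkcond (bigD1_seq (el p.2)) ?undup_uniq //=; last first.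
    by rewrite mem_undup; apply/mapP; exists p.
  by rewrite eqxx big1 ?addr0 // => w; rewrite eq_sym => /negbTE->.
have c0 : forall w, w \in ws -> c w = 0.
  apply: (hecke_free HT (undup_uniq _)); rewrite -[RHS]e grp.
  by apply: eq_bigr => w _; rewrite scaler_suml; apply: eq_bigr => p /eqP->.
rewrite grp big_seq big1 // => w ww.
transitivity (c w * f (co w)); last by rewrite c0 // mul0r.
by rewrite mulr_suml; apply: eq_bigr => p /eqP <-; rewrite elK.
Qed.

(** One list serves both for the product in [H] and for the composition of operators;
    multiplicativity of [rho] is expressed in this way, without extending it linearly to [H]. *)
Lemma gen_mul_list N j (l : seq (laurent * t3)) : exists l' : seq (laurent * t3),
  E (gen j) * (\sum_(p <- l) p.1 *: E p.2) = \sum_(p <- l') p.1 *: E p.2 /\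
  forall g, op_gen j (fun i => \sum_(p <- l) p.1 * @rho N p.2 g i)
    = fun i => \sum_(p <- l') p.1 * rho p.2 g i.
Proof.
elim: l => [|[a x] l [l' [e1 e2]]].
  exists [::]; split=> [|g]; first by rewrite !big_nil mulr0.
  apply: funext => i; rewrite big_nil /op_gen !big_nil; case: ifP => // _.
  by case: ifP => _; rewrite mulr0 ?addr0.
exists ((a, mul3 (gen j) x) :: (if desc j x then (a * q, x) :: l' else l')); split=> [|g].
  rewrite !big_cons mulrDr e1 -scalerAr gen_mul.
  by case: ifP => _ //; rewrite big_cons scalerDr scalerA addrA.
have -> : (fun i => \sum_(p <- (a, x) :: l) p.1 * rho p.2 g i) =
          fun i => a * rho x g i + \sum_(p <- l) p.1 * rho p.2 g i.
  by apply: funext => i; rewrite big_cons.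
rewrite op_genD e2 rho_gen; apply: funext => i.
case: ifP => _; last by rewrite big_cons.
by rewrite !big_cons /= mulrDr mulrA addrA.
Qed.

Lemma rho_len0_mul N x y : len x = 0%N -> len (mul3 x y) = len y /\
  forall g i, rho y g (@act N x i) = rho (mul3 x y) g i.
Proof.
move=> /len_eq0[j ej]; have -> : x = co (tau ^+ j)%g by rewrite -ej elK.
elim: j {x ej} => [|j [IH1 IH2]].
  rewrite (_ : co _ = (0, 0, We)); last first.
    by apply: el_inj; rewrite coK expg0 /el /= tc0 mul1g.
  by rewrite mul31; split=> // g i; rewrite act1.
rewrite (_ : co _ = mul3 gtau (co (tau ^+ j)%g)); last first.
  by apply: el_inj; rewrite coK -elM coK el_gtau expgS.
rewrite -mul3A len_gtau; split=> // g i.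
by rewrite actM IH2 -op_tau_rho.
Qed.

Lemma mul_list N x y : exists l : seq (laurent * t3),
  E x * E y = \sum_(p <- l) p.1 *: E p.2 /\
  forall g, @rho N x (rho y g) = fun i => \sum_(p <- l) p.1 * rho p.2 g i.
Proof.
move: {-1}(len x) (erefl (len x)) => n; elim: n x => [|n IH] x lx.
  have [h1 _] := @rho_len0_mul 0 x y lx; exists [:: (1, mul3 x y)]; split=> [|g].
    by rewrite big_seq1 scale1r E_mul // lx h1.
  apply: funext => i; have [_ h2] := @rho_len0_mul N x y lx.
  by rewrite rho_len0 // big_seq1 mul1r h2.
have /ex_desc[j dj] : (0 < len x)%N by rewrite lx.
have [|l [e1 e2]] := IH (mul3 (gen j) x); first by have := len_desc dj; lia.
have [l' [f1 f2]] := gen_mul_list N j l; exists l'; split=> [|g].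
  by rewrite -f1 -e1 mulrA gen_mul desc_gen dj genK.
by rewrite (rho_desc _ dj) e2 f2.
Qed.

Section Trace.
Variables (N : nat) (u0 : 'I_N.+2 * 'I_N.+2) (s : 'I_N.+2).
Let phi x := tr u0 s (rho x).

(** One expansion suffices: by [relation_transfer] the vanishing then holds for every expansion of
    h. *)
Definition trace_null h := exists l : seq (laurent * t3),
  h = \sum_(p <- l) p.1 *: E p.2 /\ \sum_(p <- l) p.1 * phi p.2 = 0.

Lemma trace_nullD a h h' : trace_null h -> trace_null h' -> trace_null (a *: h + h').
Proof.
move=> [l [-> e]] [l' [-> e']]; exists ([seq (a * p.1, p.2) | p <- l] ++ l').
rewrite !big_cat !big_map /= e' addr0 scaler_sumr; split.
  by congr (_ + _); apply: eq_bigr => p _; rewrite scalerA.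
by rewrite -[RHS](mulr0 a) -[in RHS]e big_distrr /=; apply: eq_bigr => p _; rewrite /= mulrA.
Qed.

Lemma trace_null0 : trace_null 0.
Proof. by exists [::]; rewrite !big_nil. Qed.

Lemma trace_null_sum (J : Type) (r : seq J) (a : J -> laurent) (F : J -> H) :
  (forall j, trace_null (F j)) -> trace_null (\sum_(j <- r) a j *: F j).
Proof.
move=> hF; elim: r => [|j r IH]; first by rewrite big_nil; exact: trace_null0.
by rewrite big_cons; apply: trace_nullD.
Qed.

Lemma trace_null_basis x y : trace_null (E x * E y - E y * E x).
Proof.
have [l [e1 e2]] := mul_list N x y; have [l' [e1' e2']] := mul_list N y x.
exists (l ++ [seq (- p.1, p.2) | p <- l']); rewrite !big_cat !big_map /= e1 e1'; split.
  congr (_ + _); rewrite -sumrN; apply: eq_bigr => p _; by rewrite scaleNr.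
have trl k z w : (forall g, @rho N z (rho w g) = fun i => \sum_(p <- k) p.1 * rho p.2 g i) ->
    tr u0 s (rho z \o rho w) = \sum_(p <- k) p.1 * phi p.2.
  move=> e; rewrite /tr /=; under eq_bigr do rewrite e.
  rewrite exchange_big /=; apply: eq_bigr => p _.
  by rewrite /phi /tr big_distrr.
under [X in _ + X]eq_bigr do rewrite mulNr.
rewrite sumrN -(trl _ _ _ e2) -(trl _ _ _ e2') tr_comm ?subrr //; exact: rho_admissible.
Qed.

Lemma trace_null_comm h h' : trace_null (h * h' - h' * h).
Proof.
have [l ->] := expand h; have [l' ->] := expand h'.
have -> : (\sum_(p <- l) p.1 *: E p.2) * (\sum_(p <- l') p.1 *: E p.2) -
  (\sum_(p <- l') p.1 *: E p.2) * (\sum_(p <- l) p.1 *: E p.2) =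
  \sum_(p <- l) p.1 *: \sum_(r <- l') r.1 *: (E p.2 * E r.2 - E r.2 * E p.2).
  rewrite big_distrl big_distrr -sumrB /=; apply: eq_bigr => p _.
  rewrite -scalerAl -scalerAr -scalerBr; congr (_ *: _).
  rewrite big_distrr big_distrl -sumrB /=; apply: eq_bigr => r _.
  by rewrite -scalerAl -scalerAr -scalerBr.
by apply: trace_null_sum => p; apply: trace_null_sum => r; exact: trace_null_basis.
Qed.

Lemma trace_commutators (l : seq (laurent * t3)) :
  commutators (\sum_(p <- l) p.1 *: E p.2) -> \sum_(p <- l) p.1 * phi p.2 = 0.
Proof.
move=> [r e].
have [l' [el' e']] : trace_null (\sum_(p <- l) p.1 *: E p.2).
  by rewrite e; apply: trace_null_sum => p; exact: trace_null_comm.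
have := @relation_transfer phi (l ++ [seq (- p.1, p.2) | p <- l']).
rewrite !big_cat !big_map /= el'.
under [X in _ + X = 0 -> _]eq_bigr do rewrite scaleNr.
under [X in _ -> _ + X = 0]eq_bigr do rewrite mulNr.
by rewrite !sumrN e' subrr subr0; apply.
Qed.

End Trace.
End Hecke.

(** * Linear independence in the cocenter *)

Lemma pol_laurent_subproof (p : {poly int}) : tofrac p \in is_laurent.
Proof. by rewrite unfold_in; apply/asboolP; exists p, 0%N; rewrite expr0 divr1. Qed.
Definition pol_laurent (p : {poly int}) : laurent := Laurent (pol_laurent_subproof p).

Lemma pol_laurentD p r : pol_laurent (p + r) = pol_laurent p + pol_laurent r.
Proof. by apply: val_inj; rewrite rmorphD /= tofracD. Qed.
Lemma pol_laurentM p r : pol_laurent (p * r) = pol_laurent p * pol_laurent r.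
Proof. by apply: val_inj; rewrite rmorphM /= tofracM. Qed.
Lemma pol_laurent1 : pol_laurent 1 = 1.
Proof. by apply: val_inj; rewrite rmorph1 /= tofrac1. Qed.
Lemma pol_laurentX : pol_laurent 'X = v.
Proof. exact: val_inj. Qed.
Lemma pol_laurentXn n : pol_laurent 'X^n = v ^+ n.
Proof.
elim: n => [|n IH]; first by rewrite !expr0 pol_laurent1.
by rewrite !exprS pol_laurentM IH pol_laurentX.
Qed.
Lemma pol_laurent_inj : injective pol_laurent.
Proof. by move=> p r /(congr1 val) /= /eqP; rewrite tofrac_eq => /eqP. Qed.

Lemma laurent_mulI (x y z : laurent) : x != 0 -> x * y = x * z -> y = z.
Proof.
move=> x0 /(congr1 val); rewrite !rmorphM => /mulfI e; apply: val_inj; apply: e.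
by apply: contraNneq x0 => e; apply/eqP; apply: val_inj; rewrite e rmorph0.
Qed.

Lemma vX_neq0 n : v ^+ n != 0.
Proof.
apply/eqP => e; have := congr1 ( *%R (vV ^+ n)) e.
rewrite -exprMn (mulrC vV) v_vV expr1n mulr0 => /eqP; by rewrite oner_eq0.
Qed.

Lemma laurent_pol (x : laurent) : exists n p, v ^+ n * x = pol_laurent p.
Proof.
case: x => x xP; have := xP; rewrite unfold_in => /asboolP[p [n e]].
exists n, p; apply: val_inj; rewrite rmorphM rmorphXn /= e mulrC divfK //.
exact: fracX_neq0.
Qed.

Definition ev_witness (x : laurent) : {np : nat * {poly int} | v ^+ np.1 * x = pol_laurent np.2}.
Proof. by apply: cid; have [n [p e]] := laurent_pol x; exists (n, p). Qed.
(** The value at v = 1; by [evE] it does not depend on the numerator chosen. *)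
Definition ev x : int := (projT1 (ev_witness x)).2.[1].

Lemma evE n x p : v ^+ n * x = pol_laurent p -> ev x = p.[1].
Proof.
rewrite /ev; case: ev_witness => -[n' p'] /= e' e.
have : 'X^n * p' = 'X^n' * p.
  by apply: pol_laurent_inj; rewrite !pol_laurentM !pol_laurentXn -e -e' mulrCA.
by move/(congr1 (horner^~ 1)); rewrite !hornerE !expr1n !mul1r.
Qed.

Lemma ev_pol p : ev (pol_laurent p) = p.[1].
Proof. by apply: (@evE 0); rewrite expr0 mul1r. Qed.

Lemma evM x y : ev (x * y) = ev x * ev y.
Proof.
have [n [p e]] := laurent_pol x; have [n' [p' e']] := laurent_pol y.
rewrite (evE e) (evE e') -hornerM; apply: (@evE (n + n')).
by rewrite pol_laurentM -e -e' exprD mulrACA.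
Qed.

Lemma evD x y : ev (x + y) = ev x + ev y.
Proof.
have [n [p e]] := laurent_pol x; have [n' [p' e']] := laurent_pol y.
have -> : ev x + ev y = ('X^n' * p + 'X^n * p').[1].
  by rewrite (evE e) (evE e') !hornerE !expr1n !mul1r.
apply: (@evE (n + n')); rewrite pol_laurentD !pol_laurentM !pol_laurentXn -e -e' exprD.
by move: (v ^+ n) (v ^+ n') => a b; ring.
Qed.

Lemma ev0 : ev 0 = 0.
Proof. by apply: (addrI (ev 0)); rewrite -evD !addr0. Qed.
Lemma ev1 : ev 1 = 1.
Proof. by rewrite -pol_laurent1 ev_pol hornerC. Qed.
Lemma ev_sum J (r : seq J) P (F : J -> laurent) :
  ev (\sum_(i <- r | P i) F i) = \sum_(i <- r | P i) ev (F i).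
Proof. exact: (big_morph ev evD ev0). Qed.
Lemma ev_v : ev v = 1.
Proof. by rewrite -pol_laurentX ev_pol hornerX. Qed.
Lemma ev_q : ev q = 0.
Proof.
have : ev v * ev vV = 1 by rewrite -evM v_vV ev1.
rewrite ev_v mul1r => e; have : ev (q + vV) = 1 by rewrite subrK ev_v.
by rewrite evD e => h; apply: (addIr 1); rewrite h add0r.
Qed.
Lemma ev_nat n : ev n%:R = n%:R.
Proof. by elim: n => [|n IH]; rewrite ?ev0 // !mulrS evD ev1 IH. Qed.

(* A relation over the Laurent polynomials is divided by v - 1 as long as its
   coefficients vanish at v = 1. *)
Lemma specialization n (d : 'I_n -> laurent) (FF : ('I_n -> laurent) -> Prop) :
  (forall c : 'I_n -> int,
     (forall F, FF F -> \sum_i c i * ev (F i) = 0) -> forall i, c i = 0) ->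
  (forall F, FF F -> \sum_i d i * F i = 0) -> forall i, d i = 0.
Proof.
move=> sep rel.
have polcase (m : nat) (P : 'I_n -> {poly int}) : (forall i, (size (P i) <= m)%N) ->
    (forall F, FF F -> \sum_i pol_laurent (P i) * F i = 0) -> forall i, P i = 0.
  elim: m P => [|m IH] P sP relP i; first by apply/eqP; rewrite -size_poly_leq0.
  have P1 k : (P k).[1] = 0.
    apply: (sep (fun k => (P k).[1])) => F hF; rewrite -[RHS]ev0 -(relP F hF) ev_sum.
    by apply: eq_bigr => j _; rewrite evM ev_pol.
  have /choice[Q PQ] k : exists Q : {poly int}, P k = Q * ('X - 1%:P).
    by apply/factor_theorem; rewrite /root P1.
  have Q0 : forall k, Q k = 0.
    apply: IH => [k|F hF].
      have [->|nQ] := eqVneq (Q k) 0; first by rewrite size_poly0.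
      have := sP k; rewrite PQ size_Mmonic ?monicXsubC // size_XsubC.
      by rewrite addn2.
    apply: (@laurent_mulI (pol_laurent ('X - 1%:P))).
      apply/eqP => /(congr1 val); rewrite rmorph0 => /eqP.
      by rewrite /= tofrac_eq0 polyXsubC_eq0.
    rewrite mulr0 -[RHS](relP F hF) mulr_sumr; apply: eq_bigr => k _.
    by rewrite mulrA -pol_laurentM mulrC [in RHS]PQ mulrC (mulrC (Q k)).
  by rewrite PQ Q0 mul0r.
pose Pn i := projT1 (ev_witness (d i)).
(* Multiplication by v^M clears all denominators at once. *)
pose M := (\sum_i (Pn i).1)%N.
pose PP i : {poly int} := 'X^(M - (Pn i).1) * (Pn i).2.
have PM i : v ^+ M * d i = pol_laurent (PP i).
  rewrite pol_laurentM pol_laurentXn -(projT2 (ev_witness (d i))) mulrA -exprD subnK //.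
  by rewrite /M (bigD1 i) //= leq_addr.
move=> i; apply: (laurent_mulI (vX_neq0 M)); rewrite mulr0 PM.
rewrite (polcase (\max_i size (PP i)) PP).
- by apply: val_inj; rewrite rmorph0 /= tofrac0.
- by move=> k; apply: (leq_bigmax (F := fun k => size (PP k))).
move=> F hF; rewrite -[RHS](mulr0 (v ^+ M)) -[in RHS](rel F hF) mulr_sumr.
by apply: eq_bigr => k _; rewrite mulrA PM.
Qed.

(* A complete invariant of conjugacy: the extreme coordinates of a translation, the
   displacement of a glide reflection along its axis, the class modulo the root
   lattice of a rotation. *)
Definition class_inv (x : t3) : int * int * int :=
  let: (a, b, w) := x in match w with
  | We => (0, Num.max (2 * a + b) (Num.max (b - a) (- a - 2 * b)),
            Num.min (2 * a + b) (Num.min (b - a) (- a - 2 * b)))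
  | Wa => (1, a + 2 * b, 0) | Wb => (1, - 2 * a - b, 0) | Waba => (1, a - b, 0)
  | _ => (2, ((a + 2 * b) %% 3)%Z, 0) end.

(** * Traces at v = 1 as numbers of fixed words *)

Section Eval.
Variable N : nat.
Local Notation G := 'I_N.+2.
Local Notation I := (G * G * G)%type.

Lemma ev_op_gen j (g : I -> laurent) i : ev (op_gen j g i) = ev (g (act (gen j) i)).
Proof.
rewrite /op_gen; case: ifP => // _; case: ifP => [/eqP e|_].
  by rewrite evM ev_v mul1r lpair_fix.
by rewrite evD evM ev_q mul0r addr0.
Qed.

Lemma ev_rho x (g : I -> laurent) i : ev (rho x g i) = ev (g (act x i)).
Proof.
move: {-1}(len x) (erefl (len x)) => n; elim: n x i => [|n IH] x i lx.
  by rewrite rho_len0.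
have /ex_desc[j dj] : (0 < len x)%N by rewrite lx.
rewrite (rho_desc g dj) ev_op_gen IH; last by have := len_desc dj; lia.
by rewrite -actM genK.
Qed.

Variables (u0 : G * G) (s : G).

Definition nfix (x : t3) : nat :=
  #|[pred u : G * G | [&& content u0 (u, 0), uact x.2 u == u & upair u x.1 == s]]|.

(** Each of the N + 2 values of the counter contributes equally, because its displacement depends
    only on the word. *)
Lemma ev_tr x : ev (tr u0 s (rho x)) = (N.+2 * nfix x)%:R.
Proof.
rewrite /tr ev_sum.
under eq_bigr => i _ do rewrite ev_rho /delta ev_nat.
rewrite -natr_sum; congr (_%:R).
rewrite (eq_bigl (fun i : I => content u0 (i.1, 0) && true)); last first.
  by move=> i; rewrite andbT.
rewrite -(pair_big (fun u => content u0 (u, 0)) (fun=> true)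
  (fun u k => (act x (u, k) == shift s (u, k)) : nat)) /=.
rewrite exchange_big /= (eq_bigr (fun=> nfix x)) => [|k _]; first by rewrite sum_nat_const card_ord.
rewrite /nfix -sum1_card big_mkcond [RHS]big_mkcond /=; apply: eq_bigr => u _.
rewrite !inE; case: (content _ _) => //=.
rewrite /act /shift /= xpair_eqE (inj_eq (addrI k)).
by case: (_ && _).
Qed.

End Eval.

Lemma intr_ord N (m : int) : (m%:~R == 0 :> 'I_N.+2) = (N.+2 %| m)%Z.
Proof.
have h (n : nat) : (n%:R == 0 :> 'I_N.+2) = (N.+2 %| n)%N.
  by rewrite -val_eqE /= Zp_nat.
by case: m => n; rewrite ?NegzE ?mulrNz ?oppr_eq0 -?pmulrn h /dvdz ?abszN.
Qed.

Lemma intr_ord_eq N (m n : int) :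
  (m%:~R == n%:~R :> 'I_N.+2) = (N.+2 %| m - n)%Z.
Proof. by rewrite -subr_eq0 -rmorphB intr_ord. Qed.

Lemma intr_ord_inj N (m n : int) :
  m%:~R = n%:~R :> 'I_N.+2 -> (`|m - n| < N.+2)%N -> m = n.
Proof.
move=> /eqP; rewrite intr_ord_eq => /dvdzP[k e] lt.
have [k0|k0] : k = 0 \/ k != 0 by case: eqP; [left | right].
  by move: e; rewrite k0 mul0r => /eqP; rewrite subr_eq0 => /eqP.
have : (N.+2 <= absz (k * N.+2%:Z)%R)%N by rewrite abszM leq_pmull // absz_gt0.
by rewrite -e leqNgt lt.
Qed.

(** Integer lifts of words and of their pairing: for large N, congruences between them become
    equalities. *)
Definition uactZ w (u : int * int) : int * int := match w with
  | We => u | Wa => (u.2 - u.1, u.2) | Wb => (u.1, u.1 - u.2)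
  | Wab => (u.2 - u.1, - u.1) | Wba => (- u.2, u.1 - u.2)
  | Waba => (- u.2, - u.1) end.

Definition upairZ (u p : int * int) : int := u.1 * p.1 + u.2 * p.2.

Section Cast.
Variable N : nat.
Definition cast2 (u : int * int) : 'I_N.+2 * 'I_N.+2 := (u.1%:~R, u.2%:~R).

Lemma uact_cast w u : uact w (cast2 u) = cast2 (uactZ w u).
Proof.
case: u => a b; rewrite /cast2.
by case: w; rewrite /= /ua /ub /= ?rmorphN ?rmorphB //=; congr (_, _); ring.
Qed.

Lemma upair_cast u p : upair (cast2 u) p = (upairZ u p)%:~R.
Proof. by rewrite /upair /upairZ /= rmorphD !rmorphM /= !mulrzr. Qed.

Lemma cast2_inj u u' : cast2 u = cast2 u' ->
  (`|u.1 - u'.1| < N.+2)%N -> (`|u.2 - u'.2| < N.+2)%N -> u = u'.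
Proof.
case: u u' => a b [a' b']; rewrite /cast2 /=.
by move=> /pair_equal_spec[ea eb] la lb; rewrite (intr_ord_inj ea la) (intr_ord_inj eb lb).
Qed.

Lemma nfix_gt0 u0 (s : int) x w : cast2 (uactZ x.2 (uactZ w u0)) = cast2 (uactZ w u0) ->
  upairZ (uactZ w u0) x.1 = s -> (0 < nfix (cast2 u0) s%:~R x)%N.
Proof.
move=> e1 e2; apply/card_gt0P; exists (cast2 (uactZ w u0)); rewrite !inE.
rewrite uact_cast e1 upair_cast e2 !eqxx !andbT.
by apply/contentP; exists w; rewrite uact_cast.
Qed.

Lemma nfix_eq0 u0 (s : 'I_N.+2) x :
  (forall w, cast2 (uactZ x.2 (uactZ w u0)) = cast2 (uactZ w u0) ->
    (upairZ (uactZ w u0) x.1)%:~R = s -> False) -> nfix (cast2 u0) s x = 0%N.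
Proof.
move=> h; apply/eqP; rewrite -leqn0 leqNgt; apply/negP => /card_gt0P[u].
rewrite !inE => /and3P[/contentP[w /= e] /eqP e1 /eqP e2]; move: e1 e2.
by rewrite e uact_cast uact_cast upair_cast => e1 e2; apply: (h w).
Qed.
End Cast.

Lemma inv_We w p : class_inv (w6act w p, We) = class_inv (p, We).
Proof.
pose f p' := class_inv (p', We); rewrite -[LHS]/(f _) -[RHS]/(f _).
have fa p' : f (acta p') = f p'.
  by case: p' => a b; rewrite /f /class_inv /acta /=; congr (_, _, _); lia.
have fb p' : f (actb p') = f p'.
  by case: p' => a b; rewrite /f /class_inv /actb /=; congr (_, _, _); lia.
by move: (f) fa fb => {}f fa fb; case: w; rewrite /= ?fa ?fb ?fa ?fb.
Qed.

Lemma upairZ_act w u p : upairZ (uactZ w u) p = upairZ u (w6act w p).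
Proof. by case: w u p => -[m n] [a b]; rewrite /upairZ /=; ring. Qed.

(** * Separation of conjugacy classes by fixed words *)

Section Separation.
Variables (n : nat) (xs : 'I_n -> t3) (c : 'I_n -> int).
Hypothesis xs_inj : forall i j, class_inv (xs i) = class_inv (xs j) -> i = j.
Hypothesis c_rel : forall N u0 s, \sum_i c i * (@nfix N u0 s (xs i))%:R = 0.

Lemma coeff0 i0 N u0 s : (0 < @nfix N u0 s (xs i0))%N ->
  (forall i, i != i0 -> c i = 0 \/ @nfix N u0 s (xs i) = 0%N) -> c i0 = 0.
Proof.
move=> h0 h; have := c_rel u0 s; rewrite (bigD1 i0) //= big1 ?addr0 => [/eqP|i /h[]->].
- by rewrite mulf_eq0 pnatr_eq0 (gtn_eqF h0) orbF => /eqP.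
- by rewrite mul0r.
- by rewrite mulr0.
Qed.

Let B := (\sum_i (`|(xs i).1.1| + `|(xs i).1.2|))%N.
Lemma bound i : (`|(xs i).1.1| + `|(xs i).1.2| <= B)%N.
Proof. by rewrite /B (bigD1 i) //= leq_addr. Qed.

(* Three distinct letters are fixed only by translations, and K is so large that
   the pairing with (K, 1) tells all the translations at hand apart. *)
Lemma coeff_translation i0 : (xs i0).2 = We -> c i0 = 0.
Proof.
(* K exceeds the differences of second coordinates, which are at most 3 B; N exceeds every
   difference compared, so that congruences become equalities. *)
pose K : int := 4 * B%:Z + 3; pose N := (`|K| * (4 * B) + 30 * B + 30)%N.
case e0 : (xs i0) => [[a0 b0] w0] /= w0e; rewrite {}w0e in e0.
apply: (@coeff0 i0 N (cast2 N (K, 1)) (K * a0 + b0)%:~R).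
  by apply: (@nfix_gt0 N (K, 1) _ _ We); rewrite e0 // /upairZ /= mul1r.
move=> i ni; right; apply: nfix_eq0 => w; case ei : (xs i) => [[a b] wi] /=.
have := bound i; have := bound i0; rewrite ei e0 /= => B0 Bi.
have [we|nwi] := pselect (wi = We); last first.
  move=> /cast2_inj h _; have {h} : uactZ wi (uactZ w (K, 1)) = uactZ w (K, 1).
    by apply: h; case: w; case: (wi); rewrite /= /N /K; lia.
  case: wi nwi {ei} => // _; case: w => /= /pair_equal_spec[]; rewrite /K; lia.
rewrite {}we in ei *; move=> _; rewrite upairZ_act /upairZ.
have : w6act w (a, b) = (a0, b0) -> False.
  move=> ew; move/eqP: ni; apply; apply: xs_inj; rewrite ei e0.
  by rewrite -(inv_We w) ew.
have : (`|(w6act w (a, b)).1| <= 2 * B)%N /\ (`|(w6act w (a, b)).2| <= 2 * B)%N.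
  by case: w; rewrite /=; lia.
case: (w6act w (a, b)) => a' b' /= [ha hb] ne e; apply: ne.
have : K * a' + 1 * b' = K * a0 + b0.
  apply: intr_ord_inj e _; rewrite (_ : _ - _ = K * (a' - a0) + (b' - b0)); last by ring.
  have : (`|(K * (a' - a0))%R| <= `|K| * (3 * B))%N by rewrite abszM leq_mul2l; lia.
  rewrite /N; lia.
have [lt|gtau|->] := ltgtP a' a0.
- have : K * (a0 - a') >= K * 1 by rewrite ler_pM2l /K; lia.
  by rewrite mulrBr /K; lia.
- have : K * (a' - a0) >= K * 1 by rewrite ler_pM2l /K; lia.
  by rewrite mulrBr /K; lia.
- by rewrite mul1r => /addrI->.
Qed.

Definition is_refl w := match w with Wa | Wb | Waba => true | _ => false end.

(* A glide reflection fixes exactly one of the words with letters 1, 1, -2, and moves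
   its counter by the displacement. *)
Lemma coeff_glide i0 : is_refl (xs i0).2 -> c i0 = 0.
Proof.
pose N := (12 * B + 30)%N; case e0 : (xs i0) => [[a0 b0] w0] /= w0r.
apply: (@coeff0 i0 N (cast2 N (1, 2)) ((class_inv (xs i0)).1.2)%:~R).
  (* The arrangement of 1, 1, -2 whose equal letters stand where the reflection exchanges them; its
     pairing is the displacement in [class_inv]. *)
  rewrite e0; apply: (@nfix_gt0 N (1, 2) _ _
    (match w0 with Wb => Wba | Waba => Wab | _ => We end)).
  - by case: (w0) w0r.
  - by case: (w0) w0r; rewrite //= /upairZ /=; lia.
move=> i ni; case ei : (xs i) => [[a b] wi].
have [we|nwi] := pselect (wi = We); first by left; apply: coeff_translation; rewrite ei.
right; apply: nfix_eq0 => w /=.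
have := bound i; have := bound i0; rewrite ei e0 /= => B0 Bi.
move=> /cast2_inj h; have {h} : uactZ wi (uactZ w (1, 2)) = uactZ w (1, 2).
  by apply: h; case: w; case: (wi); rewrite /= /N; lia.
move=> hu /intr_ord_inj h.
have : class_inv (a, b, wi) = class_inv (a0, b0, w0) -> False.
  by move=> e; move/eqP: ni; apply; apply: xs_inj; rewrite ei e0.
apply; move: h; rewrite /upairZ => h.
have {h} : (uactZ w (1, 2)).1 * a + (uactZ w (1, 2)).2 * b = (class_inv (a0, b0, w0)).1.2.
  apply: h; rewrite /class_inv; case: (w0) w0r => // _; case: (w) => /=; rewrite /N; lia.
move: hu nwi; case: wi {ei} => //; case: w => //= _ _;
  case: w0 {e0} w0r => // _ /= h; congr (_, _, _); lia.
Qed.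

(* Modulo 3 the word 1, 1, 1 has zero sum and is fixed by every rotation. *)
Lemma coeff_rotation i0 : ~~ is_refl (xs i0).2 -> (xs i0).2 <> We -> c i0 = 0.
Proof.
case e0 : (xs i0) => [[a0 b0] w0] /= w0r w0e.
apply: (@coeff0 i0 1 (cast2 1 (1, 2)) (a0 + 2 * b0)%:~R).
  rewrite e0; apply: (@nfix_gt0 1 (1, 2) _ _ We); last by rewrite /upairZ /= mul1r.
  by case: (w0) w0r w0e => //= _ _; congr (_, _); apply: val_inj.
move=> i ni; case ei : (xs i) => [[a b] wi].
have [we|nwi] := pselect (wi = We); first by left; apply: coeff_translation; rewrite ei.
have [wr|nwr] := boolP (is_refl wi); first by left; apply: coeff_glide; rewrite ei.
right; apply: nfix_eq0 => w _ /eqP; rewrite intr_ord_eq => h.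
move/eqP: ni; apply; apply: xs_inj; rewrite ei e0 /class_inv; move: h.
case: wi nwi nwr {ei} => // _ _; case: w0 w0r w0e {e0} => // _ _;
  case: w; rewrite /upairZ /= => h; congr (_, _, _); lia.
Qed.

Lemma separation i : c i = 0.
Proof.
have [we|nwe] := pselect ((xs i).2 = We); first exact: coeff_translation.
by have [|nr] := boolP (is_refl (xs i).2); [exact: coeff_glide | exact: coeff_rotation].
Qed.

End Separation.

Section Independence.
Variables (H : algType laurent) (T : ext_weyl -> H) (HT : is_hecke_algebra T).

Lemma cocenter_free n (xs : 'I_n -> t3) (d : 'I_n -> laurent) :
  (forall i j, class_inv (xs i) = class_inv (xs j) -> i = j) ->
  commutators (\sum_i d i *: T (el (xs i))) -> forall i, d i = 0.
Proof.
move=> xs_inj hd.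
apply: (@specialization _ _ (fun F => exists N (u0 : 'I_N.+2 * 'I_N.+2) s,
   F = fun i => tr u0 s (rho (xs i)))).
  move=> c hc; apply: (separation xs_inj) => N u0 s.
  have /mulfI : N.+2%:R != 0 :> int by rewrite pnatr_eq0.
  apply; rewrite mulr0 -[RHS](hc _ (ex_intro _ N (ex_intro _ u0 (ex_intro _ s erefl)))).
  rewrite mulr_sumr; apply: eq_bigr => i _.
  by rewrite ev_tr natrM mulrCA.
move=> F [N [u0 [s ->]]].
have := @trace_commutators H T HT N u0 s [seq (d i, xs i) | i <- index_enum 'I_n].
by rewrite !big_map; apply.
Qed.

End Independence.

(** * Conjugacy classes *)

(** Conjugation by g is written without an inverse, so that on [el] it becomes equations between
    coordinates. *)
Definition invariant_under (g : ext_weyl) : Prop :=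
  forall x y, (x * g = g * y)%g -> class_inv (co x) = class_inv (co y).

Lemma invariant_underM g h :
  invariant_under g -> invariant_under h -> invariant_under (g * h)%g.
Proof.
move=> ig ih x y e; have ex : (x * g = g * (g^-1 * x * g))%g by rewrite !mulgA mulgV mul1g.
rewrite (ig _ _ ex); apply: ih.
by rewrite -!mulgA e -!mulgA mulKg.
Qed.

Lemma invariant_under_all g : invariant_under g.
Proof.
have i1 : invariant_under s1.
  move=> x y; rewrite -(coK x) -(coK y) !elK -el_g1 !elM => /el_inj.
  move: (co x) (co y) => [[a b] w] [[a' b'] w'].
  by case: w; case: w'; rewrite /mul3 /= => /pair_equal_spec[/pair_equal_spec[e1 e2] //= _];
    rewrite /class_inv; congr (_, _, _); lia.
have i2 : invariant_under s2.
  move=> x y; rewrite -(coK x) -(coK y) !elK -el_g2 !elM => /el_inj.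
  move: (co x) (co y) => [[a b] w] [[a' b'] w'].
  by case: w; case: w'; rewrite /mul3 /= => /pair_equal_spec[/pair_equal_spec[e1 e2] //= _];
    rewrite /class_inv; congr (_, _, _); lia.
have it p : invariant_under (tc p).
  move=> x y; have -> : tc p = el (p, We) by rewrite /el /= mulg1.
  rewrite -(coK x) -(coK y) !elK !elM => /el_inj; case: p => c d.
  move: (co x) (co y) => [[a b] w] [[a' b'] w'].
  by case: w; case: w'; rewrite /mul3 /= => /pair_equal_spec[/pair_equal_spec[e1 e2] //= _];
    rewrite /class_inv; congr (_, _, _); lia.
have iw w : invariant_under (wd w).
  by case: w => //=; try exact: invariant_underM; [move=> x y; rewrite mulg1 mul1g => -> |
    apply: invariant_underM => //; apply: invariant_underM].
by rewrite -(coK g); apply: invariant_underM.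
Qed.

Lemma inv_conj x g : class_inv (co (x ^ g)%g) = class_inv (co x).
Proof.
by apply/esym; apply: (@invariant_under_all g); rewrite conjgE !mulgA mulgV mul1g.
Qed.

Definition cj x y := exists g, el y = (el x ^ g)%g.

Lemma cj_trans x y z : cj x y -> cj y z -> cj x z.
Proof. by move=> [g e] [h e']; exists (g * h)%g; rewrite e' e conjgM. Qed.
Lemma cj_sym x y : cj x y -> cj y x.
Proof. by move=> [g e]; exists (g^-1)%g; rewrite e conjgK. Qed.
Lemma cjP g x y : mul3 x g = mul3 g y -> cj x y.
Proof. by move=> e; exists (el g); rewrite conjgE elM e -elM mulKg. Qed.

Lemma dominant_translate p : exists w, let r := w6act w p in 0 <= r.1 /\ 0 <= r.2.
Proof.
case: p => a b.
have [|] := boolP ((0 <= a) && (0 <= b)); first by exists We; rewrite /=; lia.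
have [|] := boolP ((a <= 0) && (0 <= a + b)); first by exists Wa; rewrite /=; lia.
have [|] := boolP ((b <= 0) && (0 <= a + b)); first by exists Wb; rewrite /=; lia.
have [|] := boolP ((b <= 0) && (a <= 0)); first by exists Waba; rewrite /=; lia.
have [|] := boolP ((0 <= a) && (a + b <= 0)); first by exists Wab; rewrite /=; lia.
by exists Wba; rewrite /=; lia.
Qed.

(** For a dominant translation the extremes in [class_inv] are 2 a + b and - a - 2 b; the first case
    solves these for a and b. *)
Definition normal_form (k : int * int * int) : t3 :=
  if k.1.1 == 0 then ((k.1.2 * 2 + k.2) %/ 3, - (k.1.2 + 2 * k.2) %/ 3, We)%Z
  else (k.1.2, 0, if k.1.1 == 1 then Wa else Wab).

Lemma cj_normal_form x : cj x (normal_form (class_inv x)).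
Proof.
case: x => [[a b] w].
have wab a' b' : cj (a', b', Wab) (((a' + 2 * b') %% 3)%Z, 0, Wab).
  (* Conjugation by this translation clears the second coordinate, and r reduces the first one
     modulo 3, where a' - b' equals a' + 2 b'. *)
  pose r := ((a' - b') %/ 3)%Z.
  by apply: (@cjP (r, b' + r, We)); rewrite /mul3 /=; congr (_, _, _); rewrite /r; lia.
have wa a' b' : cj (a', b', Wa) (a' + 2 * b', 0, Wa).
  by apply: (@cjP (- b', 0, We)); rewrite /mul3 /=; congr (_, _, _); lia.
case: w; [|rewrite /normal_form /class_inv /=..].
- have [w dw] := dominant_translate (a, b); rewrite -(inv_We w).
  apply: (@cj_trans _ (w6act w (a, b), We)).
    apply: (@cjP (0, 0, w6inv w)); rewrite /mul3 /=.
    by case: (w) => /=; congr (_, _, _); lia.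
  move: dw; case: (w6act w (a, b)) => a' b' /= dw.
  rewrite /normal_form /class_inv /=.
  by apply: (@cjP (0, 0, We)); rewrite /mul3 /=; congr (_, _, _); lia.
- exact: wa.
- apply: (@cj_trans _ (- a, a + b, Waba)).
    by apply: (@cjP (0, 0, Wa)); rewrite /mul3 /=; congr (_, _, _); lia.
  apply: (@cj_trans _ (b, - a - b, Wa)); last first.
    by have := wa b (- a - b); congr (cj _ (_, _, _)); lia.
  by apply: (@cjP (0, 0, Wb)); rewrite /mul3 /=; congr (_, _, _); lia.
- exact: wab.
- apply: (@cj_trans _ (- a, a + b, Wab)).
    by apply: (@cjP (0, 0, Wa)); rewrite /mul3 /=; congr (_, _, _); lia.
  by have := wab (- a) (a + b); congr (cj _ (_, _, _)); lia.
- apply: (@cj_trans _ (a + b, - b, Wa)); last first.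
    by have := wa (a + b) (- b); congr (cj _ (_, _, _)); lia.
  by apply: (@cjP (0, 0, Wb)); rewrite /mul3 /=; congr (_, _, _); lia.
Qed.

(** Elements with equal invariants share a normal form, so the invariant is complete. *)
Lemma conj_classE x : conj_class (el x) = [set z | class_inv (co z) = class_inv x].
Proof.
apply/seteqP; split=> z /=.
  by case=> g _ <-; rewrite inv_conj elK.
move=> e; have [g eg] : cj x (co z).
  by apply: cj_trans (cj_normal_form x) _; rewrite -e; apply/cj_sym/cj_normal_form.
by exists g; rewrite // -eg coK.
Qed.

Lemma t_root_comb m n : t (root_comb m n) = el (2 * m - n, 2 * n - m, We).
Proof.
by rewrite /el /= mulg1 /tc; congr t; apply: coweight_eq; rewrite root_combE cwE.
Qed.

(** As tau = t^(omega_1) s_1 s_2, the product s_2 s_1 tau is the translation by s_2 s_1 omega_1 = -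
    omega_2. *)
Lemma O_lambda_tauE m n :
  O_lambda_tau (root_comb m n) =
  [set z | class_inv (co z) = class_inv (2 * m - n, 2 * n - m - 1, We)].
Proof.
rewrite -conj_classE /O_lambda_tau t_root_comb -el_g1 -el_g2 -el_gtau !elM.
by congr (conj_class (el _)); rewrite /mul3 /=; congr (_, _, _); lia.
Qed.

Lemma O_id_tauE : O_id_tau = [set z | class_inv (co z) = (2, 1, 0)].
Proof.
apply/seteqP; split=> z /=.
  case=> m [n [->|->]]; rewrite t_root_comb -?el_g1 -?el_g2 -?el_gtau !elM elK /class_inv /=;
  by congr (_, _, _); lia.
rewrite -{2}(coK z); case: (co z) => [[a b] [] //] /=; case=> e.
all: have [k ek] : exists k, a = 3 * k + 1 - 2 * b by exists (divz (a + 2 * b) 3); lia.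
- exists (2 * k - b), k; left.
  rewrite t_root_comb -el_gtau elM; congr el; rewrite /mul3 /=; congr (_, _, _); lia.
- exists (2 * k + 1 - b), k; right.
  rewrite t_root_comb -el_g1 -el_g2 -el_gtau !elM; congr el.
  by rewrite /mul3 /=; congr (_, _, _); lia.
Qed.

Lemma O_int_tauE i : O_int_tau i = [set z | class_inv (co z) = (1, 3 * i - 2, 0)].
Proof.
apply/seteqP; split=> z /=.
  case=> k [->|->|->]; rewrite t_root_comb -?el_g1 -?el_g2 -?el_gtau !elM elK /class_inv /=;
  by congr (_, _, _); lia.
rewrite -{2}(coK z); case: (co z) => [[a b] [] //] /=; case=> e.
- exists (2 * i - 1 - b); constructor 1.
  rewrite t_root_comb -?el_g1 -el_g2 -el_gtau !elM; congr el.
  by rewrite /mul3 /=; congr (_, _, _); lia.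
- exists (1 - 2 * i - a); constructor 3.
  rewrite t_root_comb -?el_g1 -?el_g2 -el_gtau !elM; congr el.
  by rewrite /mul3 /=; congr (_, _, _); lia.
- exists (b + i - 1); constructor 2.
  rewrite t_root_comb -?el_g1 -?el_g2 -el_gtau !elM; congr el.
  by rewrite /mul3 /=; congr (_, _, _); lia.
Qed.

(** * Reduction of the rotations *)

Lemma desc_inord0 x : desc (inord 0) x = (0 < alcove3 x).
Proof. by rewrite /desc [val _]inordK. Qed.
Lemma desc_inord1 x : desc (inord 1) x = (alcove1 x < 0).
Proof. by rewrite /desc [val _]inordK. Qed.
Lemma desc_inord2 x : desc (inord 2) x = (alcove2 x < 0).
Proof. by rewrite /desc [val _]inordK. Qed.
Lemma gen_inord0 : gen (inord 0) = g0.
Proof. by rewrite /gen (tnth_nth g0) /= inordK. Qed.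

Section Congruence.
Variables (H : algType laurent) (T : ext_weyl -> H) (HT : is_hecke_algebra T).
Implicit Types x y : t3.
Local Notation E x := (T (el x)).

Definition cong (h h' : H) : Prop := commutators (h - h').
Local Notation "h ~= h'" := (cong h h') (at level 70).

Lemma commutators_lin a (h h' : H) :
  commutators h -> commutators h' -> commutators (a *: h + h').
Proof.
move=> [l ->] [l' ->]; exists ([seq (a * p.1, p.2) | p <- l] ++ l').
rewrite big_cat big_map /= scaler_sumr; congr (_ + _).
by apply: eq_bigr => p _; rewrite scalerA.
Qed.

Lemma commutators0 : commutators (0 : H).
Proof. by exists [::]; rewrite big_nil. Qed.

Lemma cong_refl h : h ~= h.
Proof. by rewrite /cong subrr; exact: commutators0. Qed.
Lemma cong_eq x y : x = y -> E x ~= E y.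
Proof. by move=> ->; exact: cong_refl. Qed.
Lemma cong_sym h h' : h ~= h' -> h' ~= h.
Proof.
move=> e; have := commutators_lin (-1) e commutators0.
by rewrite addr0 scaleN1r opprB.
Qed.
Lemma cong_trans h h' h'' : h ~= h' -> h' ~= h'' -> h ~= h''.
Proof.
move=> e e'; have := commutators_lin 1 e e'.
by rewrite scale1r addrA subrK.
Qed.
Lemma congD h1 h2 h1' h2' : h1 ~= h1' -> h2 ~= h2' -> h1 + h2 ~= h1' + h2'.
Proof.
move=> e e'; have := commutators_lin 1 e e'.
by rewrite scale1r addrACA -opprD.
Qed.
Lemma congZ a h h' : h ~= h' -> a *: h ~= a *: h'.
Proof.
by move=> e; have := commutators_lin a e commutators0; rewrite addr0 scalerBr.
Qed.
Lemma cong_sum (J : Type) (r : seq J) (F F' : J -> H) :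
  (forall j, F j ~= F' j) -> \sum_(j <- r) F j ~= \sum_(j <- r) F' j.
Proof.
move=> e; elim: r => [|j r IH]; first by rewrite !big_nil; exact: cong_refl.
by rewrite !big_cons; apply: congD.
Qed.
Lemma cong_comm h h' : h * h' ~= h' * h.
Proof. by exists [:: (1, (h, h'))]; rewrite big_seq1 scale1r. Qed.

(** With x = s z and y = z s, both one longer than z, T_x = T_s T_z and T_y = T_z T_s differ by a
    commutator. *)
Lemma cong_same j x y : mul3 (gen j) x = mul3 y (gen j) ->
  desc j x -> len y = len x -> E x ~= E y.
Proof.
move=> e dj l; set z := mul3 (gen j) x.
have lz := len_desc dj; rewrite -/z in lz.
have lg : len (gen j) = 1%N by case: (j) => [[|[|[|//]]] ?]; rewrite /gen (tnth_nth g0).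
have ex : x = mul3 (gen j) z by rewrite genK.
have ey : y = mul3 z (gen j).
  by apply: el_inj; rewrite /z e -!elM -mulgA elM gen_sq /el /= tc0 !mulg1.
have -> : E x = E (gen j) * E z by rewrite (E_mul HT) -?ex // lg; lia.
have -> : E y = E z * E (gen j) by rewrite (E_mul HT) -?ey // lg; lia.
exact: cong_comm.
Qed.

(** Here z = s x = y s, and T_x = T_s T_z is congruent to T_z T_s = T_y T_s^2, which the quadratic
    relation expands. *)
Lemma cong_drop j x y : mul3 (gen j) x = mul3 y (gen j) ->
  desc j x -> (len y).+2 = len x -> E x ~= E y + q *: E (mul3 (gen j) x).
Proof.
move=> e dj l; set z := mul3 (gen j) x.
have lg : len (gen j) = 1%N by case: (j) => [[|[|[|//]]] ?]; rewrite /gen (tnth_nth g0).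
have ex : x = mul3 (gen j) z by rewrite genK.
have lz : len z = (len y).+1 by have := len_desc dj; rewrite -/z -l => -[].
have ez : E z = E y * E (gen j) by rewrite (E_mul HT) -?e ?lg ?lz ?addn1.
have -> : E x = E (gen j) * E z by rewrite (E_mul HT) -?ex // lg; lia.
apply: cong_trans (cong_comm _ _) _; rewrite {1}ez -mulrA (gen_sqr HT) mulrDr mulr1 -scalerAr -ez.
exact: cong_refl.
Qed.

(** T_tau is invertible, so conjugation by it is invisible modulo commutators. *)
Lemma cong_tau x y : mul3 gtau x = mul3 y gtau -> len x = len y -> E x ~= E y.
Proof.
move=> e l; have lt : len gtau = 0%N by [].
have e1 : E gtau * E x = E y * E gtau by rewrite !(E_mul HT) ?e ?lt ?addn0 // -e len_gtau // lt.
have gK : E gtau * E (mul3 gtau gtau) = 1.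
  rewrite (E_mul HT) // -[RHS](T_one HT); congr T.
  by rewrite /el /= tc0 mulg1.
have Kg : E (mul3 gtau gtau) * E gtau = 1.
  rewrite (E_mul HT) // -[RHS](T_one HT); congr T.
  by rewrite /el /= tc0 mulg1.
have -> : E x = E (mul3 gtau gtau) * (E y * E gtau) by rewrite -e1 mulrA Kg mul1r.
by apply: cong_trans (cong_comm _ _) _; rewrite -mulrA gK mulr1; exact: cong_refl.
Qed.

(** Conjugation by s_1 keeps the length of a translation. Since [cong_same] requires a descent, it
    is applied to the member with negative first coordinate. *)
Lemma cong_reflection1 a b : E (a, b, We) ~= E (- a, a + b, We).
Proof.
have h a' b' : a' < 0 -> E (a', b', We) ~= E (- a', a' + b', We).
  move=> a0; apply: (@cong_same (inord 1)); rewrite ?gen1.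
  - by rewrite /mul3 /=; congr (_, _, _); lia.
  - by rewrite desc_inord1 /alcove1 /=; lia.
  - by rewrite /len /alcove1 /alcove2 /alcove3 /=; lia.
have [/h//|gt0|->] := ltgtP a 0; last by rewrite oppr0 add0r; exact: cong_refl.
apply: cong_sym; have := h (- a) (a + b); rewrite opprK addrA addNr add0r; apply; lia.
Qed.

Lemma cong_reflection2 a b : E (a, b, We) ~= E (a + b, - b, We).
Proof.
have h a' b' : b' < 0 -> E (a', b', We) ~= E (a' + b', - b', We).
  move=> a0; apply: (@cong_same (inord 2)); rewrite ?gen2.
  - by rewrite /mul3 /=; congr (_, _, _); lia.
  - by rewrite desc_inord2 /alcove2 /=; lia.
  - by rewrite /len /alcove1 /alcove2 /alcove3 /=; lia.
have [/h//|gt0|->] := ltgtP b 0; last by rewrite oppr0 addr0; exact: cong_refl.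
apply: cong_sym; have := h (a + b) (- b); rewrite opprK addrK; apply; lia.
Qed.

Lemma cong_translation w p : E (p, We) ~= E (w6act w p, We).
Proof.
have fa p' : E (p', We) ~= E (acta p', We) by case: p' => a b; exact: cong_reflection1.
have fb p' : E (p', We) ~= E (actb p', We) by case: p' => a b; exact: cong_reflection2.
case: w; [exact: cong_refl|exact: fa|exact: fb| | |].
- exact: cong_trans (fb _) (fa _).
- exact: cong_trans (fa _) (fb _).
- exact: cong_trans (fa _) (cong_trans (fb _) (fa _)).
Qed.

Lemma cong_translation_inv p p' : class_inv (p, We) = class_inv (p', We) ->
  E (p, We) ~= E (p', We).
Proof.
have [w dw] := dominant_translate p; have [w' dw'] := dominant_translate p'.
rewrite -(inv_We w p) -(inv_We w' p') => e.
apply: cong_trans (cong_translation w p) _.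
apply: cong_trans (cong_sym (cong_translation w' p')).
suff -> : w6act w p = w6act w' p' by exact: cong_refl.
move: (w6act w p) (w6act w' p') dw dw' e => [a b] [a' b'] /= dw dw'.
by rewrite /class_inv => /pair_equal_spec[/pair_equal_spec[_ e1] e2]; congr (_, _); lia.
Qed.

(* A glide reflection of minimal length in the class with invariant (1, c, 0). *)
Definition glide_min (c : int) : t3 := ((c %% 2)%Z, (c %/ 2)%Z, Wa).

Lemma glide_drop a b : a < 0 ->
  E (a, b, Wa) ~= E (- a, a + b, Wa) + q *: E (- a, a + b, We).
Proof.
move=> a0; have -> : (- a, a + b, We) = mul3 (gen (inord 1)) (a, b, Wa).
  by rewrite gen1 /mul3 /=; congr (_, _, _); lia.
apply: cong_drop; rewrite ?gen1.
- by rewrite /mul3 /=; congr (_, _, _); lia.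
- by rewrite desc_inord1 /alcove1 /=; lia.
- by rewrite /len /alcove1 /alcove2 /alcove3 /=; lia.
Qed.

(* Conjugation by s_0 followed by a power of tau. *)
Lemma glide_shift a b : 0 < a -> 0 <= b \/ a + b <= 0 ->
  E (a, b, Wa) ~= E (2 - a, a + b - 1, Wa).
Proof.
move=> a0 hb.
have l1 : len (a, b, Wa) = len (-1 - b, 2 - a, Wb).
  by rewrite /len /alcove1 /alcove2 /alcove3 /=; lia.
apply: (@cong_trans _ (E (-1 - b, 2 - a, Wb))); last first.
  apply/cong_sym/cong_tau; first by rewrite /mul3 /=; congr (_, _, _); lia.
  by rewrite /len /alcove1 /alcove2 /alcove3 /=; lia.
have [gt0|le0] := ltP 0 (a + b).
  apply: (@cong_same (inord 0)); rewrite ?gen_inord0 //.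
  - by rewrite /mul3 /=; congr (_, _, _); lia.
  - by rewrite desc_inord0 /alcove3 /=; lia.
apply/cong_sym/(@cong_same (inord 0)); rewrite ?gen_inord0 //.
- by rewrite /mul3 /=; congr (_, _, _); lia.
- by rewrite desc_inord0 /alcove3 /=; lia.
Qed.

(** [glide_drop] followed by [glide_shift] lowers A by two and b by one, emitting one translation.
    The condition on b is what [glide_shift] requires, and it persists. *)
Lemma glide_reduction (A : nat) (b : int) : A%:Z <= b \/ b <= 0 ->
  E (- A%:Z, b, Wa) ~= E (glide_min (2 * b - A%:Z)) +
    q *: \sum_(0 <= k < uphalf A) E (A%:Z - 2 * k%:Z, b - A%:Z + k%:Z, We).
Proof.
have [m] := ubnP A; elim: m A b => // m IH [|[|A]] b Am hb.
- rewrite big_geq // scaler0 addr0; apply: cong_eq.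
  by rewrite /glide_min; congr (_, _, _); lia.
- apply: cong_trans (glide_drop _ _) _; first by lia.
  rewrite big_nat1; apply: congD.
    by apply: cong_eq; rewrite /glide_min; congr (_, _, _); lia.
  by apply/congZ/cong_eq; congr (_, _, _); lia.
apply: cong_trans (glide_drop _ _) _; first by lia.
rewrite /= big_nat_recl // scalerDr addrCA addrC.
apply: congD; last by apply/congZ/cong_eq; congr (_, _, _); lia.
apply: cong_trans (glide_shift _ _) _; [by lia|by lia|].
apply: (@cong_trans _ (E (- A%:Z, b - 1, Wa))).
  by apply: cong_eq; congr (_, _, _); lia.
apply: cong_trans (IH A (b - 1) _ _) _; [by lia|by lia|].
apply: congD; first by apply: cong_eq; rewrite /glide_min; congr (_, _, _); lia.
by apply/congZ/cong_sum => k; apply: cong_eq; congr (_, _, _); lia.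
Qed.

(* t^(m alpha_1 + n alpha_2) tau *)
Definition rotation (m n : int) : t3 := (2 * m - n + 1, 2 * n - m, Wab).

(** Conjugation by s_0 lowers the length by two and emits the glide reflection; s_2 and tau then
    restore the standard form at constant length. *)
Lemma rotation_dropl m n : m <= 2 * n - 2 -> n <= 2 * m - 2 ->
  E (rotation m n) ~= E (rotation (m - 1) n) + q *: E (1 - 2 * n + m, n - 2 * m, Wa).
Proof.
move=> h1 h2.
have -> : (1 - 2 * n + m, n - 2 * m, Wa) = mul3 (gen (inord 0)) (rotation m n).
  by rewrite gen_inord0 /mul3 /=; congr (_, _, _); lia.
apply: cong_trans (@cong_drop (inord 0) _ (m - 2 * n, n - 2 * m + 2, Wba) _ _ _) _.
- by rewrite gen_inord0 /mul3 /=; congr (_, _, _); lia.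
- by rewrite desc_inord0 /alcove3 /=; lia.
- by rewrite /len /alcove1 /alcove2 /alcove3 /=; lia.
apply: congD; last exact: cong_refl.
apply: (@cong_trans _ (E (2 - m - n, 2 * m - n - 2, Wab))).
  have l : len (m - 2 * n, n - 2 * m + 2, Wba) = len (2 - m - n, 2 * m - n - 2, Wab).
    by rewrite /len /alcove1 /alcove2 /alcove3 /=; lia.
  apply: (@cong_same (inord 2)); rewrite ?gen2 ?l //.
  - by rewrite /mul3 /=; congr (_, _, _); lia.
  - by rewrite desc_inord2 /alcove2 /=; lia.
apply/cong_sym/cong_tau; first by rewrite /mul3 /=; congr (_, _, _); lia.
by rewrite /len /alcove1 /alcove2 /alcove3 /=; lia.
Qed.

(** Near the wall n = 2 m, conjugation by s_1 and tau leads at constant length to u, where s_2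
    lowers the length by two. *)
Lemma rotation_dropr m n : 2 * m - 1 <= n <= 2 * m -> 2 <= n ->
  E (rotation m n) ~= E (rotation m (n - 1)) + q *: E (2 * m - n + 2, 2 * n - m - 2, Wa).
Proof.
move=> h1 h2; pose u : t3 := (m + n, m - 2 * n + 2, Wba).
have -> : (2 * m - n + 2, 2 * n - m - 2, Wa) = mul3 (gen (inord 2)) u.
  by rewrite gen2 /mul3 /=; congr (_, _, _); lia.
apply: (@cong_trans _ (E u)).
  apply: (@cong_trans _ (E (n - 2 * m - 1, m + n + 1, Wba))).
    have l : len (rotation m n) = len (n - 2 * m - 1, m + n + 1, Wba).
      by rewrite /len /alcove1 /alcove2 /alcove3 /=; lia.
    apply/cong_sym/(@cong_same (inord 1)); rewrite ?gen1 //.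
    - by rewrite /mul3 /=; congr (_, _, _); lia.
    - by rewrite desc_inord1 /alcove1 /=; lia.
  apply/cong_sym/cong_tau; first by rewrite /mul3 /=; congr (_, _, _); lia.
  by rewrite /len /alcove1 /alcove2 /alcove3 /=; lia.
apply: cong_drop; rewrite ?gen2.
- by rewrite /mul3 /=; congr (_, _, _); lia.
- by rewrite desc_inord2 /alcove2 /=; lia.
- by rewrite /len /alcove1 /alcove2 /alcove3 /=; lia.
Qed.

(** The last two drops, through s_0 and then s_1, emit glide reflections that are minimal already,
    the second one up to tau. *)
Lemma rotation11 : E (rotation 1 1) ~=
  E gtau + q *: (E (glide_min (-2)) + E (glide_min 1)).
Proof.
apply: (@cong_trans _ (E (-1, 1, Wba) + q *: E (glide_min (-2)))).
  rewrite (_ : glide_min _ = mul3 (gen (inord 0)) (rotation 1 1)); last by rewrite gen_inord0.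
  by apply: cong_drop; rewrite ?gen_inord0 ?desc_inord0.
rewrite scalerDr addrA addrAC; apply: congD; last exact: cong_refl.
apply: (@cong_trans _ (E gtau + q *: E (1, 0, Waba))).
  rewrite (_ : (1, 0, Waba) = mul3 (gen (inord 1)) (-1, 1, Wba)); last by rewrite gen1.
  by apply: cong_drop; rewrite ?gen1 ?desc_inord1.
apply: congD; [exact: cong_refl|apply: congZ].
by apply: cong_tau.
Qed.

End Congruence.

(** * Expansion of a rotation modulo commutators *)

Section Expansion.
Variables (H : algType laurent) (T : ext_weyl -> H) (HT : is_hecke_algebra T).
Implicit Types x y : t3.
Local Notation E x := (T (el x)).
Local Notation "h ~= h'" := (cong h h') (at level 70).

(* t^(j alpha_1 + k alpha_2) s_2 s_1 tau *)
Definition translation_rep (j k : nat) : t3 := (2 * j%:Z - k%:Z, 2 * k%:Z - j%:Z - 1, We).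

(* The two families of the theorem are merged: j <= (n + 1) / 2 iff 2 j - 1 <= n. *)
Definition lambda_sum (m n : nat) : H :=
  \sum_(2 <= j < m.+1) \sum_(((j + 1) %/ 2).+1 <= k < (minn n (2 * j - 1)).+1)
     E (translation_rep j k).

(** The index i of the theorem is 1 - m + k, and 3 i - 2 is the displacement of the class
    ([O_int_tauE]). *)
Definition glide_sum (m n : nat) : H :=
  \sum_(0 <= k < m + n) E (glide_min (3 * (1 - m%:Z + k%:Z) - 2)).

Lemma glide_sumSl m n : glide_sum m.+1 n = E (glide_min (3 * - m%:Z - 2)) + glide_sum m n.
Proof.
rewrite /glide_sum addSn big_nat_recl //; congr (E (glide_min _) + _); first by lia.
by apply: eq_bigr => k _; congr (E (glide_min _)); lia.
Qed.

Lemma glide_sumSr m n : glide_sum m n.+1 = glide_sum m n + E (glide_min (3 * n.+1%:Z - 2)).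
Proof.
by rewrite /glide_sum addnS big_nat_recr //; congr (_ + E (glide_min _)); lia.
Qed.

Lemma rotation_stepl (m n : nat) : (m.+1 <= 2 * n - 2)%N -> (n <= 2 * m)%N ->
  E (rotation m.+1 n) ~= E (rotation m n) + q *: (E (glide_min (3 * - m%:Z - 2)) +
    q *: \sum_(((m.+1 + 1) %/ 2).+1 <= k < n.+1) E (translation_rep m.+1 k)).
Proof.
move=> h1 h2; apply: cong_trans (rotation_dropl HT _ _) _; [by lia|by lia|].
apply: congD; first by apply: cong_eq; rewrite /rotation; congr (_, _, _); lia.
apply: congZ; pose A := (2 * n - m - 2)%N.
apply: (@cong_trans _ _ (E (- A%:Z, n%:Z - 2 * m.+1%:Z, Wa))).
  by apply: cong_eq; rewrite /A; congr (_, _, _); lia.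
apply: cong_trans (glide_reduction HT _) _; first by right; lia.
apply: congD; first by apply: cong_eq; congr (glide_min _); rewrite /A; lia.
(* The glide reflection emits the term k = n first, so the order is reversed before terms are
   matched. *)
apply: congZ; rewrite big_nat_rev /= -{1}[(_ %/ 2).+1]add0n big_addn.
rewrite (_ : uphalf A = (n.+1 - ((m.+1 + 1) %/ 2).+1)%N); last by rewrite /A; lia.
rewrite !big_mkord; apply: cong_sum => k.
apply: cong_translation_inv => //.
have kl := ltn_ord k.
(* The two translations differ by the rotation s_1 s_2 of W. *)
rewrite -(inv_We Wab); congr (class_inv (_, _)); rewrite /A /= /acta /actb /=; congr (_, _); lia.
Qed.

(** For n = 2 m a single [glide_shift] makes the emitted glide reflection minimal, so no translation
    appears. *)
Lemma rotation_stepr_even (m : nat) : (1 <= m)%N ->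
  E (rotation m (2 * m)%N) ~= E (rotation m (2 * m - 1)%N) +
    q *: E (glide_min (3 * (2 * m)%N%:Z - 2)).
Proof.
move=> h1; apply: cong_trans (rotation_dropr HT _ _) _; [by lia|by lia|].
apply: congD; first by apply: cong_eq; rewrite /rotation; congr (_, _, _); lia.
apply: congZ; apply: cong_trans (glide_shift HT _ _) _; [by lia|by lia|].
by apply: cong_eq; rewrite /glide_min; congr (_, _, _); lia.
Qed.

(** For n = 2 m - 1 the shifted glide reflection has A = 1 in [glide_reduction], which emits exactly
    one translation. *)
Lemma rotation_stepr_odd (m : nat) : (2 <= m)%N ->
  E (rotation m (2 * m - 1)%N) ~= E (rotation m (2 * m - 2)%N) +
    q *: (E (glide_min (3 * (2 * m - 1)%N%:Z - 2)) +
          q *: E (translation_rep m (2 * m - 1))).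
Proof.
move=> h1; apply: cong_trans (rotation_dropr HT _ _) _; [by lia|by lia|].
apply: congD; first by apply: cong_eq; rewrite /rotation; congr (_, _, _); lia.
apply: congZ; apply: cong_trans (glide_shift HT _ _) _; [by lia|by lia|].
apply: (@cong_trans _ _ (E (- 1%N%:Z, 3 * m%:Z - 2, Wa))).
  by apply: cong_eq; congr (_, _, _); lia.
apply: cong_trans (glide_reduction HT _) _; first by left; lia.
apply: congD; first by apply: cong_eq; congr (glide_min _); lia.
by rewrite big_nat1; apply/congZ/cong_eq; rewrite /translation_rep; congr (_, _, _); lia.
Qed.

(** By induction on m + n: m is lowered while n <= 2 m - 2; closer to the wall n = 2 m, n is lowered
    until this holds again. The path ends at (1, 1). *)
Lemma rotation_expansion (m n : nat) : (1 <= m)%N -> (n <= 2 * m)%N ->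
  (m <= 2 * n - 2)%N \/ m = 1%N /\ n = 1%N ->
  E (rotation m n) ~= E gtau + q *: glide_sum m n + (q ^+ 2) *: lambda_sum m n.
Proof.
have [l] := ubnP (m + n); elim: l => // l IH in m n *; move=> mnl h1 h2 h3.
have [[-> ->]|n11] := pselect (m = 1%N /\ n = 1%N).
  apply: cong_trans (rotation11 HT) _.
  rewrite /lambda_sum big_geq // scaler0 addr0 /glide_sum !big_nat_recr //= big_geq // add0r.
  apply: congD; first exact: cong_refl.
  by apply/congZ/congD; apply: cong_eq; congr (glide_min _); lia.
have {}h3 : (m <= 2 * n - 2)%N by case: h3.
have [n2|n2] := leqP n (2 * m - 2).
  case: m => // m in mnl h1 h2 h3 n11 n2 *.
  apply: cong_trans (rotation_stepl _ _) _; [by lia|by lia|].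
  apply: cong_trans (congD (IH _ _ _ _ _ _) (cong_refl _)) _; [by lia..|].
  rewrite glide_sumSl /lambda_sum [in X in cong _ X]big_nat_recr; last by lia.
  rewrite (_ : minn n (2 * m.+1 - 1) = n); last by lia.
  rewrite !scalerDr !scalerA -!expr2 /= addrACA -[_ + _ + q *: E _]addrA.
  by rewrite [X in _ + X + _]addrC; exact: cong_refl.
have [n3|n3] := eqVneq n (2 * m)%N.
  rewrite n3; apply: cong_trans (rotation_stepr_even h1) _.
  apply: cong_trans (congD (IH _ _ _ _ _ _) (cong_refl _)) _; [by lia..|].
  have e : (2 * m = (2 * m - 1).+1)%N by lia.
  (* For j <= m the cap 2 j - 1 stays below 2 m, so raising n to 2 m adds no term. *)
  have -> : lambda_sum m (2 * m) = lambda_sum m (2 * m - 1).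
    by apply: eq_big_nat => j hj; congr (\sum_(_ <= k < _.+1) _); lia.
  rewrite [in X in cong _ X]e glide_sumSr -e !scalerDr addrAC -[_ + _ + q *: E _]addrA.
  exact: cong_refl.
have {n2 n3} n2 : n = (2 * m - 1)%N by lia.
rewrite n2; apply: cong_trans (rotation_stepr_odd _) _; first by lia.
apply: cong_trans (congD (IH _ _ _ _ _ _) (cong_refl _)) _; [by lia..|].
have e : (2 * m - 1 = (2 * m - 2).+1)%N by lia.
(* Only j = m has a cap above 2 m - 2, which adds the single term k = 2 m - 1. *)
have -> : lambda_sum m (2 * m - 1) =
    lambda_sum m (2 * m - 2) + E (translation_rep m (2 * m - 1)).
  rewrite /lambda_sum big_nat_recr; last by lia.
  rewrite [in RHS]big_nat_recr /=; last by lia.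
  rewrite -addrA; congr (_ + _).
    by apply: eq_big_nat => j hj; congr (\sum_(_ <= k < _.+1) _); lia.
  rewrite (_ : minn (2 * m - 1) (2 * m - 1) = (2 * m - 2).+1); last by lia.
  by rewrite (_ : minn _ _ = (2 * m - 2)%N) ?big_nat_recr -?e //; lia.
have -> : glide_sum m (2 * m - 1) =
    glide_sum m (2 * m - 2) + E (glide_min (3 * (2 * m - 1)%N%:Z - 2)).
  by rewrite e glide_sumSr.
rewrite !scalerDr !scalerA -!expr2 addrACA -[_ + _ + q *: E _]addrA.
exact: cong_refl.
Qed.
End Expansion.

(** * Class polynomials *)

Lemma conj_class_eq x y :
  conj_class (el x) = conj_class (el y) <-> class_inv x = class_inv y.
Proof.
split=> [e|e]; last by rewrite !conj_classE e.
have : conj_class (el x) (el x) by rewrite conj_classE /= elK.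
by rewrite e conj_classE /= elK.
Qed.

Lemma conj_classesE O : conj_classes O <-> exists x, O = conj_class (el x).
Proof.
split=> [[z _ <-]|[x ->]]; first by exists (co z); rewrite coK.
by exists (el x).
Qed.

Lemma min_length_choice_ex : exists r, min_length_choice r.
Proof.
have /choice[r hr] (O : set ext_weyl) : exists x, conj_classes O ->
    O x /\ forall y, O y -> (ell x <= ell y)%N.
  have [/conj_classesE[x ->]|nO] := pselect (conj_classes O); last by exists 1%g.
  have ex : exists k, `[< exists2 y, conj_class (el x) y & ell y = k >].
    by exists (ell (el x)); apply/asboolP; exists (el x); rewrite // conj_classE /= elK.
  have [k /asboolP[y xy <-] kmin] := ex_minnP ex.
  exists y => _; split=> [|z xz]; first exact: xy.
  by apply: kmin; apply/asboolP; exists z.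
by exists r => O /hr.
Qed.

Lemma fsbig_conj_classes (H : nmodType) (F : set ext_weyl -> H) (S : seq (set ext_weyl)) :
  uniq S -> (forall O, O \in S -> conj_classes O) ->
  (forall O, conj_classes O -> O \notin S -> F O = 0) ->
  \sum_(O \in conj_classes) F O = \sum_(O <- S) F O.
Proof.
move=> uS SC F0; rewrite (fsbigE S) //.
rewrite big_mkcond; apply: eq_big_seq => O OS.
by rewrite mem_set //; apply: SC.
Qed.

Section ClassPolynomials.
Variables (H : algType laurent) (T : ext_weyl -> H) (HT : is_hecke_algebra T).
Local Notation E x := (T (el x)).

(** Both supports lie in a finite list S of classes. The difference of the two expansions is a
    relation between representatives of distinct classes, to which [cocenter_free] applies. *)
Lemma class_poly_unique w f f' :
  is_class_poly T w f -> is_class_poly T w f' -> f = f'.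
Proof.
move=> [f1 f2 f3] [f1' f2' f3']; have [r hr] := min_length_choice_ex.
have /finite_seqP[s hs] := f2; have /finite_seqP[s' hs'] := f2'.
pose S := undup (s ++ s').
have fS O : O \notin S -> f O = 0.
  rewrite mem_undup mem_cat negb_or => /andP[nO _]; apply: contrapT => /eqP fO.
  by move/negP: nO; apply; have : [set O | f O != 0] O by []; rewrite hs.
have fS' O : O \notin S -> f' O = 0.
  rewrite mem_undup mem_cat negb_or => /andP[_ nO]; apply: contrapT => /eqP fO.
  by move/negP: nO; apply; have : [set O | f' O != 0] O by []; rewrite hs'.
have SC O : O \in S -> conj_classes O.
  rewrite mem_undup mem_cat => OS; apply: contrapT => nO; case/orP: OS => OS.
    have : [set O | f O != 0] O by rewrite hs.
    by rewrite /= f1 // eqxx.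
  have : [set O | f' O != 0] O by rewrite hs'.
  by rewrite /= f1' // eqxx.
have uS : uniq S := undup_uniq _.
have := cong_trans (cong_sym (f3 r hr)) (f3' r hr).
rewrite !(fsbig_conj_classes uS SC) => [e|O _ /fS'->|O _ /fS->]; rewrite ?scale0r //.
pose n := size S; pose O_ (i : 'I_n) := nth set0 S i.
have OS i : O_ i \in S by apply: mem_nth.
have d0 : forall i, f (O_ i) - f' (O_ i) = 0.
  apply: (@cocenter_free _ T HT n (fun i => co (r (O_ i)))) => [i j eij|].
    have cls k : O_ k = conj_class (r (O_ k)).
      have [+ _] := hr _ (SC _ (OS k)); have /conj_classesE[x ->] := SC _ (OS k).
      by rewrite -{2}(coK (r _)) !conj_classE /= => ->.
    have /eqP : O_ i = O_ j.
      by rewrite cls [RHS]cls -(coK (r (O_ i))) -(coK (r (O_ j))) conj_class_eq.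
    by rewrite nth_uniq // => /eqP/val_inj.
  move: e; rewrite /cong; congr commutators.
  rewrite -sumrB (big_nth set0) big_mkord; apply: eq_bigr => i _.
  by rewrite coK scalerBl.
apply: funext => O; have [OinS|nO] := boolP (O \in S); last by rewrite fS // fS'.
have iO : (index O S < n)%N by rewrite index_mem.
have := d0 (Ordinal iO); rewrite /O_ /= nth_index // => /eqP.
by rewrite subr_eq0 => /eqP.
Qed.

Definition is_class_rep x := x = gtau \/ (exists c, x = glide_min c) \/ exists p, x = (p, We).

(** An instance of the He-Nie theorem, required because [is_class_poly] quantifies over all choices
    of minimal length representatives. The elements allowed by the length bound are linked to x by
    length-preserving conjugations. *)
Lemma cong_min_length x z : is_class_rep x -> conj_class (el x) z ->
  (forall y, conj_class (el x) y -> (ell z <= ell y)%N) -> cong (T z) (E x).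
Proof.
rewrite -(coK z); move: (co z) => {z} y hx; rewrite !conj_classE /= elK => exy lxy.
have {lxy} : (len y <= len x)%N by rewrite -!ell_el; apply: lxy; rewrite /= elK.
case: hx => [ex|[[c ex]|[p ex]]]; subst x.
- case: y exy => [[a b] []] //=; rewrite /class_inv /=; case=> e;
    rewrite /len /alcove1 /alcove2 /alcove3 /= => l;
    apply: cong_eq; rewrite ?/gtau; congr (_, _, _); lia.
- have gl a b : a + 2 * b = c -> (len (a, b, Wa) <= len (glide_min c))%N ->
      cong (E (a, b, Wa)) (E (glide_min c)).
    move=> e; rewrite /len /alcove1 /alcove2 /alcove3 /= => l.
    (* Besides [glide_min c] only a = 2 meets the bound, and [glide_shift] sends it to a = 0. *)
    have [a2|a2] := eqVneq a 2.
      apply: cong_trans (glide_shift HT _ _) _; [by lia|by lia|].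
      by apply: cong_eq; rewrite /glide_min; congr (_, _, _); lia.
    by apply: cong_eq; rewrite /glide_min; congr (_, _, _); lia.
  have {}exy : class_inv y = (1, c, 0).
    by rewrite exy /class_inv /=; congr (_, _, _); lia.
  case: y exy => [[a b] w] + ly.
  case: w ly => ly; rewrite /class_inv => /pair_equal_spec[/pair_equal_spec[//= _ e] _].
  + exact: gl.
  + have l : len (b, - a - b, Wa) = len (a, b, Wb)
      by rewrite /len /alcove1 /alcove2 /alcove3 /=; lia.
    apply: (@cong_trans _ _ (E (b, - a - b, Wa))).
      by apply/cong_sym/(cong_tau HT) => //; rewrite /mul3 /=; congr (_, _, _); lia.
    by apply: gl; rewrite ?l //; lia.
  + have l : len (2 - a - b, a - 1, Wa) = len (a, b, Waba)
      by rewrite /len /alcove1 /alcove2 /alcove3 /=; lia.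
    apply: (@cong_trans _ _ (E (2 - a - b, a - 1, Wa))).
      by apply: (cong_tau HT) => //; rewrite /mul3 /=; congr (_, _, _); lia.
    by apply: gl; rewrite ?l //; lia.
- move=> _; case: y exy => [p' w]; case: w; rewrite /class_inv /=;
    case: p => a b; case: p' => a' b' //= e.
  exact: cong_translation_inv.
Qed.

Definition class_coeff (l : seq (laurent * t3)) (O : set ext_weyl) : laurent :=
  \sum_(p <- l | conj_class (el p.2) == O) p.1.

Lemma class_coeff_eq0 l O :
  (forall p, p \in l -> conj_class (el p.2) <> O) -> class_coeff l O = 0.
Proof.
move=> h; rewrite /class_coeff big_seq_cond big1 // => p /andP[/h h' /eqP e].
by case: h'.
Qed.

Lemma class_coeff_rep l a x : uniq [seq class_inv p.2 | p <- l] -> (a, x) \in l ->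
  class_coeff l (conj_class (el x)) = a.
Proof.
move=> ul axl; rewrite /class_coeff big_mkcond (bigD1_seq (a, x)) ?(map_uniq ul) //=.
rewrite eqxx big_seq_cond big1 ?addr0 // => p /andP[pl npax].
case: eqP => // /conj_class_eq e; case/eqP: npax.
have sz p' : p' \in l -> (index p' l < size [seq class_inv p.2 | p <- l])%N.
  by rewrite size_map index_mem.
have ei : index p l = index (a, x) l.
  apply/eqP; rewrite -(nth_uniq (class_inv x) (sz _ pl) (sz _ axl) ul).
  by rewrite !(nth_map (a, x)) ?index_mem // !nth_index // e.
by rewrite -(nth_index (a, x) pl) ei nth_index.
Qed.

Lemma class_coeff_is_class_poly l w : (forall p, p \in l -> is_class_rep p.2) ->
  cong (T w) (\sum_(p <- l) p.1 *: E p.2) -> is_class_poly T w (class_coeff l).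
Proof.
move=> reps e; pose cls (p : laurent * t3) := conj_class (el p.2).
pose S := undup [seq cls p | p <- l].
have uS : uniq S := undup_uniq _.
have SC O : O \in S -> conj_classes O.
  by rewrite mem_undup => /mapP[p _ ->]; apply/conj_classesE; exists p.2.
have nS O : O \notin S -> class_coeff l O = 0.
  move=> nO; apply: class_coeff_eq0 => p pl eO; move/negP: nO; apply.
  by rewrite mem_undup; apply/mapP; exists p.
split=> [O nO||r hr].
- by apply: nS; apply/negP => /SC.
- apply: (sub_finite_set _ (finite_seq S)) => O /= h; apply: contraNT h => h.
  by rewrite nS.
rewrite (fsbig_conj_classes uS SC) => [|O _ /nS->]; last by rewrite scale0r.
have -> : \sum_(O <- S) class_coeff l O *: T (r O) = \sum_(p <- l) p.1 *: T (r (cls p)).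
  under eq_bigr do rewrite scaler_suml.
  rewrite (exchange_big_dep predT) //=; apply: eq_big_seq => p pl.
  rewrite big_mkcond (bigD1_seq (cls p)) //=; last first.
    by rewrite mem_undup; apply/mapP; exists p.
  by rewrite eqxx big1 ?addr0 // => O; rewrite eq_sym => /negbTE->.
apply: cong_trans e _; elim: l reps {S uS SC nS} => [|p l IH] reps.
  by rewrite !big_nil; exact: cong_refl.
rewrite !big_cons; apply: congD; last by apply: IH => p' pl; apply: reps; rewrite inE pl orbT.
have /reps hp : p \in p :: l by rewrite inE eqxx.
have [c1 c2] := hr (cls p) ((conj_classesE _).2 (ex_intro _ p.2 erefl)).
by apply/congZ/cong_sym/cong_min_length.
Qed.

Definition Lambda_seq (m n : nat) : seq (nat * nat) :=
  [seq (j, k) | j <- index_iota 2 m.+1,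
                k <- index_iota ((j + 1) %/ 2).+1 (minn n (2 * j - 1)).+1].

Definition class_terms (m n : nat) : seq (laurent * t3) :=
  (1, gtau) :: [seq (q, glide_min (3 * (1 - m%:Z + k%:Z) - 2)) | k <- index_iota 0 (m + n)]
  ++ [seq (q ^+ 2, translation_rep p.1 p.2) | p <- Lambda_seq m n].

Lemma class_terms_sum m n : \sum_(p <- class_terms m n) p.1 *: E p.2 =
  E gtau + q *: glide_sum T m n + q ^+ 2 *: lambda_sum T m n.
Proof.
rewrite big_cons big_cat !big_map /= scale1r addrA big_allpairs_dep /=.
by congr (_ + _ + _); rewrite scaler_sumr //; apply: eq_bigr => j _; rewrite scaler_sumr.
Qed.

Lemma Lambda_seqP m n j k : ((j, k) \in Lambda_seq m n) =
  [&& (2 <= j <= m)%N, ((j + 1) %/ 2 < k)%N, (k <= n)%N & (k <= 2 * j - 1)%N].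
Proof.
apply/allpairsPdep/idP => [[j' [k' [+ + [-> ->]]]]|h]; last exists j, k; rewrite ?mem_index_iota.
  by lia.
by split=> //; lia.
Qed.

Lemma class_terms_uniq m n : uniq [seq class_inv p.2 | p <- class_terms m n].
Proof.
(* The bounds on k make these translations dominant, so the extremes in [class_inv] are explicit and
   determine j and k. *)
have invl j k : (j, k) \in Lambda_seq m n -> class_inv (translation_rep j k) =
    (0, 3 * j%:Z - 1, 2 - 3 * k%:Z).
  by rewrite Lambda_seqP /class_inv /translation_rep => h; congr (_, _, _); lia.
have invg c : class_inv (glide_min c) = (1, c, 0).
  by rewrite /class_inv /=; congr (_, _, _); lia.
have -> : [seq class_inv p.2 | p <- class_terms m n] = (2, 1, 0) ::
    [seq (1, 3 * (1 - m%:Z + k%:Z) - 2, 0) | k <- index_iota 0 (m + n)] ++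
    [seq (0, 3 * p.1%:Z - 1, 2 - 3 * p.2%:Z) | p <- Lambda_seq m n].
  rewrite /class_terms map_cons map_cat -!map_comp; congr (_ :: _ ++ _).
    by apply: eq_map => k; exact: invg.
  by apply/eq_in_map => -[j k] jk; exact: invl.
rewrite cons_uniq mem_cat cat_uniq; apply/and4P; split.
- by rewrite negb_or; apply/andP; split; apply/negP => /mapP[].
- rewrite map_inj_uniq ?iota_uniq // => k k' [] e; lia.
- by apply/hasPn => z /mapP[? _ ->]; apply/negP => /mapP[].
rewrite map_inj_uniq => [|[j k] [j' k'] [] e e']; last by congr (_, _); lia.
apply: allpairs_uniq_dep => [|j _|]; [exact: iota_uniq | exact: iota_uniq |].
by move=> [j k] [j' k'] _ _ /= [-> ->].
Qed.

Lemma class_terms_rep m n p : p \in class_terms m n -> is_class_rep p.2.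
Proof.
rewrite inE mem_cat => /or3P[/eqP->|/mapP[k _ ->]|/mapP[jk _ ->]]; first by left.
  by right; left; eexists.
by right; right; eexists.
Qed.

Lemma class_poly_rotation m n : (1 <= m)%N -> (n <= 2 * m)%N -> (m <= 2 * n - 2)%N ->
  class_poly T (el (rotation m n)) = class_coeff (class_terms m n).
Proof.
move=> h1 h2 h3; apply: xget_unique => [|f hf]; last first.
  apply: class_poly_unique hf _; apply: class_coeff_is_class_poly (@class_terms_rep m n) _.
  by rewrite class_terms_sum; apply: (rotation_expansion HT) => //; left.
apply: class_coeff_is_class_poly (@class_terms_rep m n) _.
by rewrite class_terms_sum; apply: (rotation_expansion HT) => //; left.
Qed.

End ClassPolynomials.

Theorem proposition2p32 (H : algType laurent) (T : ext_weyl -> H)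
    (HT : is_hecke_algebra T) (m n : nat) (m_gt0 : (0 < m)%N) (n_gt0 : (0 < n)%N)
    (mn_dom : dominant (root_comb m n)) (mn_sh : root_lattice_sh (root_comb m n))
    (m_neq : m%:Z <> 2 * n%:Z - 1) (n_neq : n%:Z <> 2 * m%:Z - 1) :
  let f := class_poly T (t (root_comb m n) * tau)%g in
  let Lambda : set coweight :=
    (\bigcup_(j in [set j : nat | (2 <= j <= (n + 1) %/ 2)%N])
       E'_tau j (2 * j - 1)) `|`
    (\bigcup_(j in [set j : nat | ((n + 1) %/ 2 + 1 <= j <= m)%N])
       E'_tau j n) in
  [/\ forall lambda, Lambda lambda -> f (O_lambda_tau lambda) = (v - vV) ^+ 2,
      forall i : int, 1 - m%:Z <= i <= n%:Z -> f (O_int_tau i) = v - vV,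
      f O_id_tau = 1
    & forall O, conj_classes O ->
        ~ (exists2 lambda, Lambda lambda & O = O_lambda_tau lambda) ->
        ~ (exists2 i : int, 1 - m%:Z <= i <= n%:Z & O = O_int_tau i) ->
        O <> O_id_tau -> f O = 0].
Proof.
move=> f Lambda.
(* Dominance gives m <= 2 n and n <= 2 m; [mn_sh] excludes equality, and [m_neq] and [n_neq] exclude
   the next value. *)
have [hm hn] : (m <= 2 * n - 2)%N /\ (n <= 2 * m - 2)%N.
  have [_ nsh] := mn_sh.
  have := mn_dom ord0; have := mn_dom ord_max; rewrite !root_combE => d1 d2.
  have m2 : m%:Z <> 2 * n%:Z.
    by move=> e; apply: nsh; exists n%:Z; constructor 2; rewrite -e.
  have n2 : n%:Z <> 2 * m%:Z.
    by move=> e; apply: nsh; exists m%:Z; constructor 1; rewrite -e.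
  lia.
have fE : f = class_coeff (class_terms m n).
  rewrite -(class_poly_rotation HT) //; last by lia.
  by rewrite /f t_root_comb -el_gtau elM; congr (class_poly T (el _)); rewrite /mul3 /=;
    congr (_, _, _); lia.
have Ol j k : O_lambda_tau (root_comb j%:Z k%:Z) = conj_class (el (translation_rep j k)).
  by rewrite O_lambda_tauE conj_classE.
have Oi i : O_int_tau i = conj_class (el (glide_min (3 * i - 2))).
  rewrite O_int_tauE conj_classE (_ : class_inv (glide_min _) = (1, 3 * i - 2, 0)) //.
  by rewrite /class_inv /=; congr (_, _, _); lia.
have Oid : O_id_tau = conj_class (el gtau) by rewrite O_id_tauE conj_classE.
have LambdaE lambda : Lambda lambda <->
    exists j k : nat, (j, k) \in Lambda_seq m n /\ lambda = root_comb j k.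
  split=> [[[j /= hj [k [hk ->]]]|[j /= hj [k [hk ->]]]]|[j [k [+ ->]]]].
  - by exists j, k; split=> //; rewrite Lambda_seqP; lia.
  - by exists j, k; split=> //; rewrite Lambda_seqP; lia.
  rewrite Lambda_seqP => h; have [le|gtau] := leqP j ((n + 1) %/ 2).
    by left; exists j; rewrite /=; [lia | exists k; split=> //; lia].
  by right; exists j; rewrite /=; [lia | exists k; split=> //; lia].
have rep a x : (a, x) \in class_terms m n -> f (conj_class (el x)) = a.
  by move=> ax; rewrite fE; apply: class_coeff_rep ax; exact: class_terms_uniq.
split.
- move=> lambda /LambdaE[j [k [jk ->]]]; rewrite Ol; apply: rep.
  rewrite inE mem_cat; apply/orP; right; apply/orP; right.
  by apply/mapP; exists (j, k).
- move=> i hi; rewrite Oi; apply: rep.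
  rewrite inE mem_cat; apply/orP; right; apply/orP; left.
  (* This k solves i = 1 - m + k; it is nonnegative by the lower bound on i. *)
  apply/mapP; exists (absz (i + m%:Z - 1)%R); first by rewrite mem_index_iota; lia.
  by congr (_, glide_min _); lia.
- by rewrite Oid; apply: rep; rewrite inE eqxx.
move=> O _ nl ni nid; rewrite fE; apply: class_coeff_eq0 => p.
rewrite inE mem_cat => /or3P[/eqP->|/mapP[k hk ->]|/mapP[[j k] jk ->]] e.
- by apply: nid; rewrite Oid -e.
- apply: ni; exists (1 - m%:Z + k%:Z); last by rewrite Oi -e.
  by move: hk; rewrite mem_index_iota; lia.
- apply: nl; exists (root_comb j%:Z k%:Z); last by rewrite Ol -e.
  by apply/LambdaE; exists j, k.
Qed.
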